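(* Let $a,b\in\mathbb{C}$ and let $h$ be a nonconstant meromorphic function on $\mathbb{H}$ satisfying \[ \{h,\tau\} = a\,\bigl(\theta_3(\tau)\theta_4(\tau)\bigr)^4 + b\,\theta_2(\tau)^8, \] and suppose $h$ is a modular function for some finite-index subgroup of $\mathrm{SL}_2(\mathbb{Z})$. Let $m_1$ be the least positive integer with $h(\tau+m_1)=h(\tau)$ for all $\tau$, and $m_2$ the least positive integer with $h\bigl(\tfrac{\tau}{1-m_2\tau}\bigr)=h(\tau)$ for all $\tau$. Let $n_1$ be the positive integer such that, for a linear fractional transformation $\gamma\in\mathrm{PGL}_2(\mathbb{C})$ with $\gamma\circ h(\tau)\to 0$ as $\mathrm{Im}\,\tau\to\infty$, one has $\gamma(h(\tau))=\sum_{k\ge n_1}c_k e^{2\pi i k\tau/m_1}$ with $c_{n_1}\neq 0$; and let $n_2$ be the positive integer such that, for $\gamma\in\mathrm{PGL}_2(\mathbb{C})$ with $\gamma(h(-1/\tau))\to 0$ as $\mathrm{Im}\,\tau\to\infty$, one has $\gamma(h(-1/\tau))=\sum_{k\ge n_2}d_k e^{2\pi i k\tau/m_2}$ with $d_{n_2}\neq 0$. Then \[ a = 2\pi^2\left(\frac{n_1}{m_1}\right)^2\quad\text{and}\quad b = 2\pi^2\left(\frac{n_2}{m_2}\right)^2 . \]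
   Context: $\mathbb{H}$ is the upper half-plane; $\{h,\tau\}=\left(\frac{h''}{h'}\right)'-\frac12\left(\frac{h''}{h'}\right)^2$ is the Schwarzian derivative. $\theta_2(\tau)=\sum_{n\in\mathbb{Z}}e^{\pi i (n+1/2)^2\tau}$, $\theta_3(\tau)=\sum_{n\in\mathbb{Z}}e^{\pi i n^2\tau}$, $\theta_4(\tau)=\sum_{n\in\mathbb{Z}}(-1)^ne^{\pi i n^2\tau}$. A modular function for a finite-index subgroup is a meromorphic function on $\mathbb{H}$ invariant under it and meromorphic at all cusps. The maps $\tau\mapsto\tau+1$ and $\tau\mapsto \tau/(1-2\tau)$ correspond to the matrices $T=\begin{pmatrix}1&1\\0&1\end{pmatrix}$ and $R=\begin{pmatrix}1&0\\2&1\end{pmatrix}$ generating $\Gamma_0(2)$ modulo $\pm I$; $m_1$ and $m_2$ are the widths of the cusps $\infty$ and $0$ for the invariance group of $h$ inside $\Gamma_0(2)$. (The integers $n_1,n_2$ do not depend on the choice of $\gamma$.) *)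

(* Defs.v *)
(* Stdlib reals with Coquelicot's complex numbers [C]. *)
From Stdlib Require Import Reals ZArith List.
From Coquelicot Require Import Coquelicot.
Open Scope C_scope.

Definition Cexp (z : C) : C :=
  ((exp (Re z) * cos (Im z))%R, (exp (Re z) * sin (Im z))%R).

Definition upper_half_plane (z : C) : Prop := (0 < Im z)%R.

(* Neighbourhoods of i*oo: the filter behind "as Im tau -> oo" and
   "for Im tau large enough". *)
Definition at_i_infty (P : C -> Prop) : Prop :=
  exists Y : R, forall tau : C, (Y < Im tau)%R -> P tau.

Record mat2 (A : Type) : Type := Mat2 { m11 : A; m12 : A; m21 : A; m22 : A }.
Arguments Mat2 {A}.
Arguments m11 {A}.
Arguments m12 {A}.
Arguments m21 {A}.
Arguments m22 {A}.

(** * Theta constants *)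

Definition CSeries (a : nat -> C) : C :=
  iota (T := CompleteNormedModule.CompleteSpace C_AbsRing C_CompleteNormedModule)
    (fun l : C => is_series (K := C_AbsRing) (V := C_NormedModule) a l).

Lemma CSeries_unique (a : nat -> C) (l : C) :
  is_series (K := C_AbsRing) (V := C_NormedModule) a l -> CSeries a = l.
Proof.
intros Ha.
apply (iota_unique (V := C_CompleteNormedModule)); [|exact Ha].
intros y Hy.
exact (filterlim_locally_unique (V := C_NormedModule) _ _ _ Hy Ha).
Qed.

Definition ZSeries (f : Z -> C) : C :=
  CSeries (fun n => f (Z.of_nat n)) + CSeries (fun n => f (- Z.of_nat n - 1)%Z).

Definition theta2 (tau : C) : C :=
  ZSeries (fun n => Cexp (RtoC PI * Ci * RtoC (IZR n + / 2) ^ 2 * tau)).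

Definition theta3 (tau : C) : C :=
  ZSeries (fun n => Cexp (RtoC PI * Ci * RtoC (IZR n) ^ 2 * tau)).

Definition theta4 (tau : C) : C :=
  ZSeries (fun n => (if Z.even n then RtoC 1 else RtoC (-1)) *
                    Cexp (RtoC PI * Ci * RtoC (IZR n) ^ 2 * tau)).

(** * The Riemann sphere *)

Inductive P1 : Type := Fin (z : C) | Infty.

(* The two standard charts [z] and [1/z]; the value at the point outside the
   domain of a chart is a dummy. *)
Definition chart0 (p : P1) : C :=
  match p with Fin z => z | Infty => RtoC 0 end.

Definition chart_infty (p : P1) : C :=
  match p with Fin z => / z | Infty => RtoC 0 end.

(* Action of GL_2(C) on the sphere.  It factors through PGL_2(C), whose
   elements are represented by invertible matrices. *)
Definition mobius (g : mat2 C) (p : P1) : P1 :=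
  match p with
  | Fin z => if Ceq_dec (m21 g * z + m22 g) (RtoC 0) then Infty
             else Fin ((m11 g * z + m12 g) / (m21 g * z + m22 g))
  | Infty => if Ceq_dec (m21 g) (RtoC 0) then Infty else Fin (m11 g / m21 g)
  end.

Definition GL2C (g : mat2 C) : Prop := m11 g * m22 g - m12 g * m21 g <> RtoC 0.

(** * Meromorphic functions on the upper half-plane *)

(* A meromorphic function is a holomorphic map to the sphere that is not
   identically infinite.  Only the values on the upper half-plane matter. *)
Definition holomorphic_at (h : C -> P1) (z0 : C) : Prop :=
  match h z0 with
  | Fin _ => locally (T := C_UniformSpace) z0 (fun z : C =>
      h z <> Infty /\
      ex_derive (K := C_AbsRing) (V := C_NormedModule)
        (fun w : C => chart0 (h w)) z)
  | Infty => locally (T := C_UniformSpace) z0 (fun z : C =>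
      h z <> Fin (RtoC 0) /\
      ex_derive (K := C_AbsRing) (V := C_NormedModule)
        (fun w : C => chart_infty (h w)) z)
  end.

Definition meromorphic_on_H (h : C -> P1) : Prop :=
  (forall tau, upper_half_plane tau -> holomorphic_at h tau) /\
  (exists tau, upper_half_plane tau /\ h tau <> Infty).

Definition nonconstant_on_H (h : C -> P1) : Prop :=
  exists tau1 tau2, upper_half_plane tau1 /\ upper_half_plane tau2 /\
    h tau1 <> h tau2.

(* [C_derive] is computed along the real direction; it agrees with the complex
   derivative wherever the latter exists ([is_C_derive_unique]), hence near any
   point where f is holomorphic and f' <> 0. *)
Definition schwarzian (f : C -> C) (z : C) : C :=
  let u := fun w => C_derive (C_derive f) w / C_derive f w in
  C_derive u z - RtoC (/ 2) * u z ^ 2.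

(* The identity {h, tau} = F(tau) of meromorphic functions: it is required at
   every point where the formula for the Schwarzian makes sense, i.e. away from
   the poles and the critical points of h. *)
Definition schwarzian_eq_on_H (h : C -> P1) (F : C -> C) : Prop :=
  forall tau, upper_half_plane tau -> h tau <> Infty ->
    C_derive (fun w => chart0 (h w)) tau <> RtoC 0 ->
    schwarzian (fun w => chart0 (h w)) tau = F tau.

(** * Modular functions *)

Definition SL2Z (s : mat2 Z) : Prop := (m11 s * m22 s - m12 s * m21 s = 1)%Z.

Definition mulZ (s t : mat2 Z) : mat2 Z :=
  Mat2 (m11 s * m11 t + m12 s * m21 t)%Z (m11 s * m12 t + m12 s * m22 t)%Z
       (m21 s * m11 t + m22 s * m21 t)%Z (m21 s * m12 t + m22 s * m22 t)%Z.

Definition oneZ : mat2 Z := Mat2 1%Z 0%Z 0%Z 1%Z.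

(* The inverse of a matrix of determinant 1. *)
Definition invZ (s : mat2 Z) : mat2 Z :=
  Mat2 (m22 s) (- m12 s)%Z (- m21 s)%Z (m11 s).

Definition finite_index_subgroup (G : mat2 Z -> Prop) : Prop :=
  (forall s, G s -> SL2Z s) /\
  G oneZ /\
  (forall s t, G s -> G t -> G (mulZ s t)) /\
  (forall s, G s -> G (invZ s)) /\
  (exists reps : list (mat2 Z), forall s, SL2Z s ->
     exists g r, G g /\ In r reps /\ s = mulZ g r).

Definition actH (s : mat2 Z) (tau : C) : C :=
  (RtoC (IZR (m11 s)) * tau + RtoC (IZR (m12 s))) /
  (RtoC (IZR (m21 s)) * tau + RtoC (IZR (m22 s))).

(* f(tau) = sum_{k >= N} c_k e^{2 pi i k tau / m} for Im tau large enough. *)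
Definition has_q_expansion (m : nat) (N : Z) (c : Z -> C) (f : C -> P1) : Prop :=
  at_i_infty (fun tau => exists l : C, f tau = Fin l /\
    is_series (K := C_AbsRing) (V := C_NormedModule)
      (fun j : nat => c (N + Z.of_nat j)%Z *
         Cexp (RtoC 2 * RtoC PI * Ci * RtoC (IZR (N + Z.of_nat j)) * tau
               / RtoC (INR m))) l).

(* The cusps are the points s(oo) with s in SL_2(Z). *)
Definition meromorphic_at_cusps (h : C -> P1) : Prop :=
  forall s, SL2Z s -> exists (m : nat) (N : Z) (c : Z -> C),
    (0 < m)%nat /\ has_q_expansion m N c (fun tau => h (actH s tau)).

Definition modular_function (h : C -> P1) (G : mat2 Z -> Prop) : Prop :=
  meromorphic_on_H h /\
  (forall g, G g -> forall tau, upper_half_plane tau -> h (actH g tau) = h tau) /\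
  meromorphic_at_cusps h.

(** * Local data at the cusps *)

Definition least_positive (P : nat -> Prop) (m : nat) : Prop :=
  (0 < m)%nat /\ P m /\ (forall k : nat, (0 < k)%nat -> P k -> (m <= k)%nat).

Definition tends_to_0_at_i_infty (f : C -> P1) : Prop :=
  forall eps : posreal, at_i_infty (fun tau =>
    exists l : C, f tau = Fin l /\ (Cmod l < eps)%R).

(* The positive integer n at which the expansion of g o f starts, for a
   transformation g sending the value of f at i*oo to 0. *)
Definition ramification_at_i_infty (f : C -> P1) (m n : nat) : Prop :=
  (0 < n)%nat /\
  exists g : mat2 C, GL2C g /\
    tends_to_0_at_i_infty (fun tau => mobius g (f tau)) /\
    exists c : Z -> C, c (Z.of_nat n) <> RtoC 0 /\
      has_q_expansion m (Z.of_nat n) c (fun tau => mobius g (f tau)).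

(* Main.v *)
(* The limit of {h, tau} at a cusp determines the ramification of h there.
   If g o h = sum_{k >= n} c_k q^k with q = exp(2 pi i tau / m) and c_n <> 0, then
   each derivative of g o h is asymptotic to the previous one times 2 pi i n / m,
   so the Schwarzian, which is Moebius invariant, tends to
   - (2 pi i n / m)^2 / 2 = 2 pi^2 (n / m)^2 at i*oo.  At the cusp oo the right-hand
   side tends to a, since theta3, theta4 -> 1 and theta2 -> 0.  At the cusp 0 one
   applies {h(-1/tau), tau} = tau^-4 {h, -1/tau}; it is enough to let tau = i x^2,
   x -> +oo, and there the behaviour of the theta constants at i / x^2 follows from
   comparing (1/x) sum_k exp(- pi ((k + s) / x)^2) with the Gaussian integral, so the
   inversion formulas are not needed. *)
Require Import Defs.
From Stdlib Require Import Reals ZArith Lra Lia.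
From Coquelicot Require Import Coquelicot.

(* Makes the type of an equation syntactically [T], as [ring] and [field] require. *)
Ltac eq_in T := match goal with |- ?x = ?y => change (@eq T x y) end.

Open Scope R_scope.

(** * The Gaussian integral *)

(** [C_derive] is total and looks only in the real direction, while [h_schwarz] speaks only at
    points where h is finite with nonzero derivative. An expansion at a cusp is therefore converted
    into a jet: explicit first, second and third complex derivatives on a whole half-plane
    [Y < Im tau], the first one without zeros. On an open set the iterated [C_derive] must agree
    with such a jet, and both side conditions of [h_schwarz] come with it. The jet is stable under
    Moebius maps, which undoes the auxiliary transformation at the cusp, and under [-1/tau], which
    carries the cusp 0 to infinity. On the imaginary axis the theta constants are real Gaussian
    sums, and errors of order [1/x] suffice. At [i / x^2] the factor [(i / x^2)^4 = x^-8] hands one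
    [1/x] to each of the eight theta factors of a summand; so scaled, [theta2] and [theta3] tend to
    1 and [theta4] to 0, which isolates b. *)

Lemma exp_le_compat (x y : R) : x <= y -> exp x <= exp y.
Proof.
intros [H | ->]; [apply Rlt_le, exp_increasing, H|apply Rle_refl].
Qed.

Definition gauss (u : R) : R := exp (- (PI * u ^ 2)).

Definition gauss_int (x : R) : R := RInt gauss 0 x.

Lemma continuous_gauss (u : R) : continuous gauss u.
Proof.
apply (ex_derive_continuous (V := R_NormedModule)). unfold gauss. auto_derive. exact I.
Qed.

Lemma ex_RInt_gauss (a b : R) : ex_RInt gauss a b.
Proof. apply (ex_RInt_continuous (V := R_CompleteNormedModule)). intros; apply continuous_gauss. Qed.

Lemma is_derive_gauss_int (x : R) : is_derive gauss_int x (gauss x).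
Proof.
apply (is_derive_RInt gauss gauss_int 0 x).
- apply filter_forall. intros y. apply (RInt_correct (V := R_CompleteNormedModule)), ex_RInt_gauss.
- apply continuous_gauss.
Qed.

(** The factor [1 + s^2] produced by the x-derivative of the exponent cancels the denominator; what
    remains integrates over s to a multiple of [gauss x * gauss_int x], which is also what
    differentiating [gauss_int x ^ 2] gives. *)
Definition polar_kernel (x s : R) : R := exp (- (PI * x ^ 2 * (1 + s ^ 2))) / (1 + s ^ 2).

Lemma one_plus_sqr_pos (s : R) : 0 < 1 + s ^ 2.
Proof. generalize (pow2_ge_0 s); lra. Qed.

Lemma is_derive_polar_kernel (x s : R) :
  is_derive (fun u => polar_kernel u s) x
    (- (2 * PI * x) * exp (- (PI * x ^ 2 * (1 + s ^ 2)))).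
Proof.
assert (H := one_plus_sqr_pos s).
unfold polar_kernel. auto_derive; [lra|]. simpl in *. field. lra.
Qed.

Lemma ex_RInt_polar_kernel (x : R) : ex_RInt (polar_kernel x) 0 1.
Proof.
apply (ex_RInt_continuous (V := R_CompleteNormedModule)). intros s _.
apply (ex_derive_continuous (V := R_NormedModule)).
unfold polar_kernel. auto_derive. generalize (one_plus_sqr_pos s); simpl; lra.
Qed.

Lemma is_derive_RInt_polar_kernel (x : R) :
  is_derive (fun u => RInt (polar_kernel u) 0 1) x
    (- (2 * PI) * gauss x * gauss_int x).
Proof.
replace (- (2 * PI) * gauss x * gauss_int x)
  with (RInt (fun s => Derive (fun u => polar_kernel u s) x) 0 1).
- apply (is_derive_RInt_param polar_kernel 0 1 x).
  + apply filter_forall. intros y t _. eexists. apply is_derive_polar_kernel.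
  + intros t _.
    apply (continuity_2d_pt_ext
      (fun u v => - (2 * PI * u) * exp (- (PI * u ^ 2 * (1 + v ^ 2))))).
    { intros u v. symmetry. apply is_derive_unique, is_derive_polar_kernel. }
    assert (Hsq : forall u v, continuity_2d_pt (fun u v => u ^ 2) u v).
    { intros u v. apply (continuity_2d_pt_ext (fun u v => u * u)); [intros; ring|].
      apply continuity_2d_pt_mult; apply continuity_2d_pt_id1. }
    assert (Hsq' : forall u v, continuity_2d_pt (fun u v => v ^ 2) u v).
    { intros u v. apply (continuity_2d_pt_ext (fun u v => v * v)); [intros; ring|].
      apply continuity_2d_pt_mult; apply continuity_2d_pt_id2. }
    apply continuity_2d_pt_mult.
    * apply continuity_2d_pt_opp, continuity_2d_pt_mult;
        [apply continuity_2d_pt_const|apply continuity_2d_pt_id1].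
    * apply (continuity_1d_2d_pt_comp exp).
      { apply derivable_continuous_pt, derivable_pt_exp. }
      apply continuity_2d_pt_opp, continuity_2d_pt_mult.
      { apply continuity_2d_pt_mult; [apply continuity_2d_pt_const|apply Hsq]. }
      apply continuity_2d_pt_plus; [apply continuity_2d_pt_const|apply Hsq'].
  + apply filter_forall. intros y. apply ex_RInt_polar_kernel.
(* The exponential splits as [gauss x * gauss (x s)], and the substitution [u = x s] rebuilds
   [gauss_int x]. The added 0 is the constant term of that affine substitution. *)
- rewrite (RInt_ext _ (fun s => - (2 * PI) * gauss x * (x * gauss (x * s + 0)))).
  2:{ intros s _. etransitivity; [exact (is_derive_unique _ _ _ (is_derive_polar_kernel x s))|].
      unfold gauss.
      replace (exp (- (PI * x ^ 2 * (1 + s ^ 2))))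
        with (exp (- (PI * x ^ 2)) * exp (- (PI * (x * s + 0) ^ 2)))
        by (rewrite <- exp_plus; f_equal; ring).
      eq_in R. ring. }
  assert (Hex : ex_RInt (fun s => x * gauss (x * s + 0)) 0 1).
  { apply (ex_RInt_comp_lin (V := R_NormedModule) gauss x 0 0 1), ex_RInt_gauss. }
  etransitivity; [exact (RInt_scal (V := R_CompleteNormedModule)
    (fun s => x * gauss (x * s + 0)) 0 1 (- (2 * PI) * gauss x) Hex)|].
  apply (f_equal (Rmult (- (2 * PI) * gauss x))).
  etransitivity; [exact (RInt_comp_lin (V := R_CompleteNormedModule) gauss x 0 0 1
    (ex_RInt_gauss _ _))|].
  unfold gauss_int. f_equal; eq_in R; ring.
Qed.

(* The square of the half integral plus the integral of the polar kernel has
   zero derivative; at [x = 0] it equals [atan 1 / PI]. *)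
Lemma gauss_int_sqr (x : R) :
  0 < x -> gauss_int x ^ 2 + RInt (polar_kernel x) 0 1 / PI = / 4.
Proof.
intros Hx. assert (HPI := PI_RGT_0).
transitivity (gauss_int 0 ^ 2 + RInt (polar_kernel 0) 0 1 / PI).
- symmetry.
  apply (eq_is_derive (V := R_NormedModule)
    (fun x => gauss_int x ^ 2 + RInt (polar_kernel x) 0 1 / PI) 0 x); [|exact Hx].
  intros t _.
  assert (H1 := is_derive_gauss_int t). assert (H2 := is_derive_RInt_polar_kernel t).
  evar_last.
  + apply (is_derive_plus (V := R_NormedModule)).
    * apply (is_derive_pow gauss_int 2 t _ H1).
    * apply (is_derive_ext (fun u => / PI * RInt (polar_kernel u) 0 1)).
      { intros u. unfold Rdiv. apply Rmult_comm. }
      apply is_derive_scal, H2.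
  + unfold plus, zero; simpl. field. lra.
- assert (H0 : gauss_int 0 = 0) by apply (RInt_point (V := R_CompleteNormedModule)).
  rewrite H0.
  rewrite (RInt_ext _ (fun s => / (1 + s ^ 2))).
  2:{ intros s _. unfold polar_kernel.
      replace (- (PI * 0 ^ 2 * (1 + s ^ 2))) with 0 by ring.
      rewrite exp_0. unfold Rdiv. apply Rmult_1_l. }
  assert (HI : is_RInt (fun s => / (1 + s ^ 2)) 0 1 (minus (atan 1) (atan 0))).
  { apply (is_RInt_derive atan).
    - intros s _. evar_last; [apply is_derive_atan|]. unfold Rsqr. f_equal. ring.
    - intros s _. apply (ex_derive_continuous (V := R_NormedModule)).
      auto_derive. generalize (one_plus_sqr_pos s); simpl; lra. }
  rewrite (is_RInt_unique _ _ _ _ HI), atan_1, atan_0.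
  unfold minus, plus, opp; simpl. field. lra.
Qed.

(** The kernel is largest at [s = 0]. Together with [gauss_int_sqr] this gives the value 1/2 of the
    half-line integral with an explicit error. *)
Lemma RInt_polar_kernel_bounds (x : R) : 0 <= RInt (polar_kernel x) 0 1 <= gauss x.
Proof.
assert (HPI := PI_RGT_0).
split.
- apply RInt_ge_0; [lra|apply ex_RInt_polar_kernel|].
  intros s _. apply Rlt_le, Rdiv_lt_0_compat; [apply exp_pos|apply one_plus_sqr_pos].
- replace (gauss x) with (RInt (fun _ => gauss x) 0 1).
  2:{ rewrite RInt_const. unfold scal; simpl; unfold mult; simpl. ring. }
  apply RInt_le; [lra|apply ex_RInt_polar_kernel|apply ex_RInt_const|].
  intros s _. assert (Hs := one_plus_sqr_pos s). unfold polar_kernel.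
  apply Rle_div_l; [exact Hs|].
  apply Rle_trans with (gauss x * 1).
  + rewrite Rmult_1_r. apply exp_le_compat.
    generalize (pow2_ge_0 s) (pow2_ge_0 x); intros.
    assert (0 <= PI * x ^ 2 * s ^ 2)
      by (apply Rmult_le_pos; [apply Rmult_le_pos; lra|assumption]).
    lra.
  + apply Rmult_le_compat_l; [apply Rlt_le, exp_pos|].
    generalize (pow2_ge_0 s); lra.
Qed.

Lemma gauss_decr (x y : R) : 0 <= x <= y -> gauss y <= gauss x.
Proof.
intros [Hx Hy]. assert (HPI := PI_RGT_0). apply exp_le_compat, Ropp_le_contravar.
apply Rmult_le_compat_l; [lra|]. apply pow_incr. lra.
Qed.

Lemma gauss_le_1 (x : R) : gauss x <= 1.
Proof.
rewrite <- exp_0. apply exp_le_compat. assert (HPI := PI_RGT_0).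
generalize (pow2_ge_0 x); intros.
assert (0 <= PI * x ^ 2) by (apply Rmult_le_pos; lra). lra.
Qed.

Lemma gauss_int_step (x d : R) : 0 <= x -> 0 <= d ->
  d * gauss (x + d) <= gauss_int (x + d) - gauss_int x <= d * gauss x.
Proof.
intros Hx Hd.
assert (H : gauss_int (x + d) - gauss_int x = RInt gauss x (x + d)).
{ unfold gauss_int.
  rewrite <- (RInt_Chasles (V := R_CompleteNormedModule) gauss 0 x (x + d))
    by apply ex_RInt_gauss.
  unfold plus; simpl. ring. }
rewrite H. clear H.
assert (Hc : forall c, d * c = RInt (fun _ => c) x (x + d)).
{ intros c. rewrite RInt_const. unfold scal; simpl; unfold mult; simpl. ring. }
rewrite !Hc. split.
- apply RInt_le; [lra|apply ex_RInt_const|apply ex_RInt_gauss|].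
  intros t Ht. apply gauss_decr; lra.
- apply RInt_le; [lra|apply ex_RInt_gauss|apply ex_RInt_const|].
  intros t Ht. apply gauss_decr; lra.
Qed.

Lemma gauss_int_bounds (x : R) : 0 <= x ->
  0 <= gauss_int x <= x /\ / 2 - gauss x <= gauss_int x <= / 2.
Proof.
intros Hx. assert (HPI := PI2_3_2).
assert (H0 : gauss_int 0 = 0) by apply (RInt_point (V := R_CompleteNormedModule)).
assert (Hs := gauss_int_step 0 x (Rle_refl _) Hx).
rewrite Rplus_0_l, H0, Rminus_0_r in Hs.
assert (Hp : 0 < gauss x) by apply exp_pos.
assert (Hp0 := gauss_le_1 0).
assert (H1 : 0 <= gauss_int x <= x) by nra.
split; [exact H1|].
destruct (Rle_lt_or_eq_dec 0 x Hx) as [Hx'|<-].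
- assert (HE := gauss_int_sqr x Hx').
  (* With G the integral up to x, [(1/2 - G)(1/2 + G) = K / PI <= gauss x / 2]; since
     [1/2 + G >= 1/2], this gives [1/2 - G <= gauss x]. *)
  destruct (RInt_polar_kernel_bounds x) as [HK0 HK1].
  set (K := RInt (polar_kernel x) 0 1) in *.
  assert (HKP : 0 <= K / PI <= gauss x / 2).
  { split; [apply Rle_div_r; lra|]. apply Rle_div_l; [lra|]. nra. }
  nra.
- rewrite H0. unfold gauss. replace (- (PI * 0 ^ 2)) with 0 by ring. rewrite exp_0. lra.
Qed.

(** * Gaussian sums *)

(** Terms of half a theta series at [tau = i t]: the shift s is 1/2 for [theta2], and 0 or 1 for the
    halves of [theta3] and [theta4] with or without the index 0. *)
Definition gauss_term (s t : R) (n : nat) : R := exp (- (PI * ((INR n + s) ^ 2 * t))).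

Definition gauss_sum (s t : R) : R := Series (gauss_term s t).

Definition gauss_alt_sum (s t : R) : R := Series (fun n => (-1) ^ n * gauss_term s t n).

Lemma gauss_term_pos (s t : R) (n : nat) : 0 < gauss_term s t n.
Proof. apply exp_pos. Qed.

Lemma exp_pow (x : R) (n : nat) : exp x ^ n = exp (INR n * x).
Proof.
induction n as [|n IH].
- simpl. rewrite Rmult_0_l, exp_0. reflexivity.
- rewrite S_INR, Rmult_plus_distr_r, exp_plus, <- IH, Rmult_1_l. simpl. ring.
Qed.

(** Since [n^2 >= n] for a natural number n, [(n + s)^2 >= s^2 + n], and the right-hand side is
    linear in n. *)
Lemma gauss_term_le_geom (s t : R) (n : nat) : 0 <= s -> 0 <= t ->
  gauss_term s t n <= gauss_term s t 0 * exp (- (PI * t)) ^ n.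
Proof.
intros Hs Ht. rewrite exp_pow. unfold gauss_term. rewrite <- exp_plus.
apply exp_le_compat. assert (HPI := PI_RGT_0).
assert (H : s ^ 2 + INR n <= (INR n + s) ^ 2).
{ destruct n as [|n]; [simpl; nra|]. rewrite S_INR.
  generalize (pos_INR n); nra. }
assert (H1 : PI * ((s ^ 2 + INR n) * t) <= PI * ((INR n + s) ^ 2 * t)).
{ apply Rmult_le_compat_l; [lra|]. apply Rmult_le_compat_r; lra. }
simpl (INR 0). nra.
Qed.

Lemma gauss_ratio_bounds (t : R) : 0 < t -> 0 < exp (- (PI * t)) < 1.
Proof.
intros Ht. split; [apply exp_pos|]. rewrite <- exp_0. apply exp_increasing.
assert (HPI := PI_RGT_0). assert (0 < PI * t) by (apply Rmult_lt_0_compat; lra). lra.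
Qed.

Lemma is_series_gauss_geom (s t : R) : 0 < t ->
  is_series (fun n => gauss_term s t 0 * exp (- (PI * t)) ^ n)
    (gauss_term s t 0 * / (1 - exp (- (PI * t)))).
Proof.
intros Ht. assert (H := gauss_ratio_bounds t Ht).
apply (is_series_scal (V := R_NormedModule) (gauss_term s t 0)), is_series_geom.
rewrite Rabs_pos_eq; lra.
Qed.

Lemma ex_series_gauss_term (s t : R) : 0 <= s -> 0 < t -> ex_series (gauss_term s t).
Proof.
intros Hs Ht.
apply (ex_series_le (V := R_CompleteNormedModule) _
  (fun n => gauss_term s t 0 * exp (- (PI * t)) ^ n)).
- intros n. change (Rabs (gauss_term s t n) <= gauss_term s t 0 * exp (- (PI * t)) ^ n).
  rewrite Rabs_pos_eq by apply Rlt_le, gauss_term_pos.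
  apply gauss_term_le_geom; lra.
- eexists. apply is_series_gauss_geom, Ht.
Qed.

Lemma exp_opp_le_inv (x : R) : 0 < x -> exp (- x) <= / x.
Proof.
intros Hx. rewrite exp_Ropp. apply Rinv_le_contravar; [exact Hx|].
generalize (exp_ineq1 x ltac:(lra)). lra.
Qed.

Lemma gauss_term_0_le (s t : R) : / 2 <= s -> 1 <= t -> gauss_term s t 0 <= 2 / t.
Proof.
intros Hs Ht. assert (HPI := PI2_3_2).
apply Rle_trans with (exp (- (t / 2))).
- apply exp_le_compat. simpl INR. rewrite Rplus_0_l.
  assert (/ 4 <= s ^ 2) by nra.
  assert (/ 4 * t <= s ^ 2 * t) by (apply Rmult_le_compat_r; lra). nra.
- eapply Rle_trans; [apply exp_opp_le_inv; lra|]. apply Req_le. field. lra.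
Qed.

Lemma gauss_sum_bounds (s t : R) : / 2 <= s -> 1 <= t ->
  0 <= gauss_sum s t <= 4 / t.
Proof.
intros Hs Ht. assert (HPI := PI2_3_2).
assert (H := is_series_gauss_geom s t ltac:(lra)).
assert (Hex := ex_series_gauss_term s t ltac:(lra) ltac:(lra)).
assert (Hle : forall n, 0 <= gauss_term s t n <= gauss_term s t 0 * exp (- (PI * t)) ^ n).
{ intros n. split; [apply Rlt_le, gauss_term_pos|apply gauss_term_le_geom; lra]. }
split.
- replace 0 with (Series (fun n => 0 * gauss_term s t n)).
  + apply Series_le; [|exact Hex].
    intros n. generalize (Hle n). nra.
  + rewrite Series_scal_l. ring.
- apply Rle_trans with (gauss_term s t 0 * / (1 - exp (- (PI * t)))).
  + rewrite <- (is_series_unique _ _ H). apply Series_le; [exact Hle|eexists; exact H].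
  (* For [t >= 1] the ratio is at most 1/2, so the geometric series costs a factor 2 over its first
     term, itself at most [2 / t]. *)
  + assert (Hq : exp (- (PI * t)) <= / 2).
    { eapply Rle_trans; [apply exp_opp_le_inv; nra|]. apply Rinv_le_contravar; nra. }
    replace (4 / t) with (2 / t * / / 2) by (field; lra).
    apply Rmult_le_compat.
    * apply Rlt_le, gauss_term_pos.
    * apply Rlt_le, Rinv_0_lt_compat. lra.
    * apply gauss_term_0_le; lra.
    * apply Rinv_le_contravar; lra.
Qed.

(** With [t = d^2] the sum is a Riemann sum of mesh d for a decreasing function. From above, each
    term is compared with the interval to its left; the first term has none and contributes the
    extra d. *)
Lemma sum_n_gauss_term_bounds (s d : R) (N : nat) : 0 <= s -> 0 < d ->
  gauss_int ((INR N + 1 + s) * d) - gauss_int (s * d) <=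
    d * sum_n (gauss_term s (d ^ 2)) N <=
  d + gauss_int ((INR N + s) * d) - gauss_int (s * d).
Proof.
intros Hs Hd.
assert (Hg : forall n, gauss_term s (d ^ 2) n = gauss ((INR n + s) * d)).
{ intros n. unfold gauss_term, gauss. f_equal. ring. }
assert (Hst : forall n, d * gauss ((INR n + 1 + s) * d) <=
  gauss_int ((INR n + 1 + s) * d) - gauss_int ((INR n + s) * d)
  <= d * gauss ((INR n + s) * d)).
{ intros n. assert (Hn := pos_INR n).
  replace ((INR n + 1 + s) * d) with ((INR n + s) * d + d) by ring.
  apply gauss_int_step; [apply Rmult_le_pos; lra|lra]. }
induction N as [|N IH].
- rewrite sum_O, Hg. specialize (Hst O). simpl INR in *.
  rewrite !Rplus_0_l in *. generalize (gauss_le_1 (s * d)). nra.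
- rewrite sum_Sn, Hg. change plus with Rplus.
  assert (H1 := Hst N). assert (H2 := Hst (S N)). rewrite S_INR in *. lra.
Qed.

(** The Riemann sum tends to the integral from [s d] to infinity, which misses 1/2 by at most
    [s d <= d]. *)
Lemma gauss_sum_near_0 (s d : R) : 0 <= s <= 1 -> 0 < d ->
  Rabs (d * gauss_sum s (d ^ 2) - / 2) <= d.
Proof.
intros Hs Hd.
assert (Ht : 0 < d ^ 2) by (apply pow_lt; exact Hd).
assert (Hex := ex_series_gauss_term s (d ^ 2) ltac:(lra) Ht).
assert (Hlim : is_lim_seq (fun N => d * sum_n (gauss_term s (d ^ 2)) N)
  (d * gauss_sum s (d ^ 2))).
{ apply (is_lim_seq_scal_l _ d (gauss_sum s (d ^ 2))). apply (Series_correct _ Hex). }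
(* The deficit [gauss ((N + 1 + s) d)] of the truncated integral is the next term of the series
   itself, so it tends to 0. *)
assert (H0 := is_lim_seq_incr_1 (gauss_term s (d ^ 2)) 0).
apply proj1 in H0. specialize (H0 (ex_series_lim_0 _ Hex)).
assert (Hsd : 0 <= s * d <= d) by nra.
destruct (gauss_int_bounds (s * d) (proj1 Hsd)) as [B1 _].
apply Rabs_le. split.
- cut (/ 2 - 0 - d <= d * gauss_sum s (d ^ 2)); [lra|].
  refine (is_lim_seq_le _ _ (/ 2 - 0 - d) (d * gauss_sum s (d ^ 2)) _ _ Hlim).
  2:{ apply is_lim_seq_minus'; [|apply is_lim_seq_const].
      apply is_lim_seq_minus'; [apply is_lim_seq_const|exact H0]. }
  intros N. cbv beta.
  destruct (sum_n_gauss_term_bounds s d N ltac:(lra) Hd) as [H _].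
  assert (Hp : 0 <= (INR N + 1 + s) * d).
  { generalize (pos_INR N). intros. apply Rmult_le_pos; lra. }
  destruct (gauss_int_bounds _ Hp) as [_ [B2 _]].
  replace (gauss_term s (d ^ 2) (S N)) with (gauss ((INR N + 1 + s) * d)).
  + lra.
  + unfold gauss_term, gauss. rewrite S_INR. f_equal. ring.
- cut (d * gauss_sum s (d ^ 2) <= d + / 2); [lra|].
  refine (is_lim_seq_le _ _ (d * gauss_sum s (d ^ 2)) (d + / 2) _ Hlim (is_lim_seq_const _)).
  intros N. cbv beta.
  destruct (sum_n_gauss_term_bounds s d N ltac:(lra) Hd) as [_ H].
  assert (Hp : 0 <= (INR N + s) * d).
  { generalize (pos_INR N). intros. apply Rmult_le_pos; lra. }
  destruct (gauss_int_bounds _ Hp) as [_ [_ B2]]. lra.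
Qed.

Lemma ex_series_gauss_alt (s t : R) : 0 <= s -> 0 < t ->
  ex_series (fun n => (-1) ^ n * gauss_term s t n).
Proof.
intros Hs Ht. apply ex_series_Rabs.
apply (ex_series_ext (gauss_term s t)); [|apply ex_series_gauss_term; assumption].
intros n. rewrite Rabs_mult, pow_1_abs, Rmult_1_l.
symmetry. apply Rabs_pos_eq, Rlt_le, gauss_term_pos.
Qed.

(** Leibniz criterion for alternating series. The bound stays below 1 as t tends to 0, whereas
    [gauss_sum] grows like [1 / (2 sqrt t)]; this contrast makes the a-term vanish at the cusp 0. *)
Lemma gauss_alt_sum_bounds (s t : R) : 0 <= s -> 0 < t ->
  0 <= gauss_alt_sum s t <= gauss_term s t 0.
Proof.
intros Hs Ht.
assert (Hdec : Un_decreasing (gauss_term s t)).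
{ intros n. apply exp_le_compat, Ropp_le_contravar.
  apply Rmult_le_compat_l; [apply Rlt_le, PI_RGT_0|].
  apply Rmult_le_compat_r; [lra|]. apply pow_incr.
  rewrite S_INR. generalize (pos_INR n). lra. }
destruct (alternated_series_ineq (gauss_term s t) (gauss_alt_sum s t) 0 Hdec) as [H1 H2].
- apply is_lim_seq_Reals, ex_series_lim_0, ex_series_gauss_term; assumption.
- apply is_series_Reals, Series_correct, ex_series_gauss_alt; assumption.
- unfold tg_alt in H1, H2. simpl in H1, H2. specialize (Hdec O). lra.
Qed.

Open Scope C_scope.

(** * Complex differentiation *)

(** [AbsRing_NormedModule C_AbsRing] has the discs of the modulus as balls, [C_NormedModule]
    products of real balls. The norm is the same, so differentiability passes from one to the other:
    the product rule is used in the first, [C_derive] in the second. *)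
Notation is_holo_derive :=
  (is_derive (K := C_AbsRing) (V := AbsRing_NormedModule C_AbsRing)).
Notation Clocally := (locally (T := AbsRing_UniformSpace C_AbsRing)).

Lemma is_holo_derive_C (f : C -> C) (z l : C) :
  is_holo_derive f z l -> is_derive (K := C_AbsRing) (V := C_NormedModule) f z l.
Proof.
intros [Hl Hd]; split; [|exact Hd].
apply (is_linear_scal_l (V := C_NormedModule)).
Qed.

Lemma is_holo_derive_eps (f : C -> C) (z l : C) :
  (forall eps : R, (0 < eps)%R -> exists d : R, (0 < d)%R /\ forall w : C,
     (Cmod (w - z) < d)%R ->
     (Cmod (f w - f z - l * (w - z)) <= eps * Cmod (w - z))%R) ->
  is_holo_derive f z l.
Proof.
intros H; split.
- apply (is_linear_scal_l (V := AbsRing_NormedModule C_AbsRing)).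
- intros x Hx.
  apply (is_filter_lim_locally_unique (V := AbsRing_NormedModule C_AbsRing)) in Hx; subst x.
  intros eps.
  destruct (H eps (cond_pos eps)) as [d [Hd Hf]].
  exists (mkposreal d Hd); intros w Hw.
  specialize (Hf w Hw); rewrite (Cmult_comm l) in Hf; exact Hf.
Qed.

Lemma is_holo_derive_eq (f : C -> C) (z l l' : C) :
  is_holo_derive f z l -> l = l' -> is_holo_derive f z l'.
Proof. intros H <-; exact H. Qed.

Lemma is_holo_derive_plus (f g : C -> C) (z df dg : C) :
  is_holo_derive f z df -> is_holo_derive g z dg ->
  is_holo_derive (fun w => f w + g w) z (df + dg).
Proof. exact (is_derive_plus (V := AbsRing_NormedModule C_AbsRing) f g z df dg). Qed.

Lemma is_holo_derive_mult (f g : C -> C) (z df dg : C) :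
  is_holo_derive f z df -> is_holo_derive g z dg ->
  is_holo_derive (fun w => f w * g w) z (df * g z + f z * dg).
Proof. intros Hf Hg; exact (is_derive_mult (K := C_AbsRing) f g z df dg Hf Hg Cmult_comm). Qed.

Lemma is_holo_derive_const (c z : C) : is_holo_derive (fun _ => c) z (RtoC 0).
Proof. exact (is_derive_const (V := AbsRing_NormedModule C_AbsRing) c z). Qed.

Lemma is_holo_derive_id (z : C) : is_holo_derive (fun w => w) z (RtoC 1).
Proof. exact (is_derive_id (K := C_AbsRing) z). Qed.

Lemma is_holo_derive_comp (f g : C -> C) (z df dg : C) :
  is_holo_derive f (g z) df -> is_holo_derive g z dg ->
  is_holo_derive (fun w => f (g w)) z (dg * df).
Proof. exact (is_derive_comp (V := AbsRing_NormedModule C_AbsRing) f g z df dg). Qed.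

Lemma is_holo_derive_inv (z : C) :
  z <> RtoC 0 -> is_holo_derive Cinv z (- / (z * z)).
Proof.
intros Hz; apply is_holo_derive_eps; intros eps Heps.
assert (Hm : (0 < Cmod z)%R) by (apply Cmod_gt_0, Hz).
set (m := Cmod z) in *.
(* The remainder is [(w - z)^2 / (z^2 w)]: the first radius keeps [Cmod w] above [m / 2], the second
   then makes the quotient by [w - z] at most eps. *)
exists (Rmin (m / 2) (eps * (m * m * m) / 2)); split.
{ apply Rmin_pos; [lra|]. assert (0 < m * m * m)%R by
    (repeat apply Rmult_lt_0_compat; exact Hm).
  assert (0 < eps * (m * m * m))%R by (apply Rmult_lt_0_compat; assumption). lra. }
intros w Hw.
assert (Hw1 : (Cmod (w - z) < m / 2)%R) by (eapply Rlt_le_trans; [exact Hw|apply Rmin_l]).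
assert (Hw2 : (Cmod (w - z) < eps * (m * m * m) / 2)%R)
  by (eapply Rlt_le_trans; [exact Hw|apply Rmin_r]).
assert (Hwm : (m / 2 < Cmod w)%R).
{ generalize (Cmod_triangle (w - z) (- w)); rewrite Cmod_opp.
  replace (w - z + - w) with (- z) by ring. rewrite Cmod_opp. fold m. lra. }
assert (Hw0 : w <> RtoC 0) by (apply Cmod_gt_0; lra).
replace (/ w - / z - - / (z * z) * (w - z)) with ((w - z) * ((w - z) / (z * z * w)))
  by (field; split; assumption).
rewrite Cmod_mult, Rmult_comm.
apply Rmult_le_compat_r; [apply Cmod_ge_0|].
assert (Hzz : z * z * w <> RtoC 0) by (repeat apply Cmult_neq_0; assumption).
rewrite Cmod_div by exact Hzz.
rewrite !Cmod_mult. fold m.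
assert (Hpos : (0 < m * m * Cmod w)%R) by
  (repeat apply Rmult_lt_0_compat; lra).
apply Rle_div_l; [exact Hpos|].
apply Rle_trans with (eps * (m * m * m) / 2)%R; [lra|].
apply Rle_trans with (eps * (m * m) * (m / 2))%R; [apply Req_le; field|].
replace (eps * (m * m * Cmod w))%R with (eps * (m * m) * Cmod w)%R by ring.
apply Rmult_le_compat_l; [|lra].
repeat apply Rmult_le_pos; lra.
Qed.

Lemma is_holo_derive_div (f g : C -> C) (z df dg : C) :
  g z <> RtoC 0 -> is_holo_derive f z df -> is_holo_derive g z dg ->
  is_holo_derive (fun w => f w / g w) z ((df * g z - f z * dg) / (g z * g z)).
Proof.
intros Hg Hf Hdg.
assert (H := is_holo_derive_mult f (fun w => / g w) z df _ Hf
  (is_holo_derive_comp Cinv g z _ dg (is_holo_derive_inv _ Hg) Hdg)).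
replace ((df * g z - f z * dg) / (g z * g z))
  with (df * / g z + f z * (dg * (- / (g z * g z)))) by (field; exact Hg).
exact H.
Qed.

Lemma is_holo_derive_ext_loc (f g : C -> C) (z l : C) :
  Clocally z (fun w => f w = g w) -> is_holo_derive f z l -> is_holo_derive g z l.
Proof. exact (is_derive_ext_loc (V := AbsRing_NormedModule C_AbsRing) f g z l). Qed.

Lemma is_holo_derive_continuous (f : C -> C) (z l : C) :
  is_holo_derive f z l -> filterlim f (Clocally z) (Clocally (f z)).
Proof.
intros H. apply (ex_derive_continuous (V := AbsRing_NormedModule C_AbsRing)).
exists l; exact H.
Qed.

(** * Exponential *)

Lemma Cexp_plus (z w : C) : Cexp (z + w) = Cexp z * Cexp w.
Proof.
destruct z as [x y], w as [u v]; unfold Cexp, Cmult, Cplus; simpl.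
rewrite exp_plus, cos_plus, sin_plus; f_equal; ring.
Qed.

Lemma Cexp_0 : Cexp (RtoC 0) = RtoC 1.
Proof. unfold Cexp, RtoC; simpl. rewrite exp_0, cos_0, sin_0; f_equal; ring. Qed.

Lemma Cexp_pow (z : C) (n : nat) : Cexp z ^ n = Cexp (RtoC (INR n) * z).
Proof.
induction n as [|n IH].
- simpl. rewrite <- Cexp_0. f_equal; ring.
- rewrite S_INR, RtoC_plus, Cmult_plus_distr_r, Cexp_plus, <- IH, Cmult_1_l.
  simpl; ring.
Qed.

Lemma Cmod_Cexp (z : C) : Cmod (Cexp z) = exp (Re z).
Proof.
unfold Cmod, Cexp; simpl.
replace (_ + _)%R with (exp (Re z) ^ 2 * (Rsqr (sin (Im z)) + Rsqr (cos (Im z))))%R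
  by (unfold Rsqr; ring).
rewrite sin2_cos2, Rmult_1_r. apply sqrt_pow2, Rlt_le, exp_pos.
Qed.

Lemma Cexp_neq_0 (z : C) : Cexp z <> RtoC 0.
Proof. apply Cmod_gt_0. rewrite Cmod_Cexp. apply exp_pos. Qed.

Lemma derivable_pt_lim_eps (f : R -> R) (x l eps : R) :
  derivable_pt_lim f x l -> (0 < eps)%R ->
  exists d : R, (0 < d)%R /\ forall t : R, (Rabs t < d)%R ->
    (Rabs (f (x + t) - f x - l * t) <= eps * Rabs t)%R.
Proof.
intros H Heps. destruct (H eps Heps) as [d Hd].
exists d; split; [apply cond_pos|]. intros t Ht.
destruct (Req_dec t 0) as [->|H0].
- rewrite Rplus_0_r, Rmult_0_r, Rabs_R0.
  replace (f x - f x - 0)%R with 0%R by ring. rewrite Rabs_R0; lra.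
- specialize (Hd t H0 Ht).
  replace (f (x + t) - f x - l * t)%R with (((f (x + t) - f x) / t - l) * t)%R
    by (field; exact H0).
  rewrite Rabs_mult. apply Rmult_le_compat_r; [apply Rabs_pos|lra].
Qed.

Lemma is_holo_derive_Cexp_0 : is_holo_derive Cexp (RtoC 0) (RtoC 1).
Proof.
apply is_holo_derive_eps; intros eps Heps.
destruct (derivable_pt_lim_eps exp 0 _ (Rmin (eps / 8) 1) (derivable_pt_lim_exp 0))
  as [d1 [Hd1 He]]; [apply Rmin_pos; lra|].
destruct (derivable_pt_lim_eps cos 0 _ (eps / 16) (derivable_pt_lim_cos 0))
  as [d2 [Hd2 Hc]]; [lra|].
destruct (derivable_pt_lim_eps sin 0 _ (eps / 16) (derivable_pt_lim_sin 0))
  as [d3 [Hd3 Hs]]; [lra|].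
rewrite sin_0 in Hc; rewrite cos_0 in Hs; rewrite exp_0 in He.
exists (Rmin (Rmin d1 (Rmin d2 d3)) (Rmin (/ 2) (eps / 16))); split.
{ repeat apply Rmin_pos; lra. }
intros w Hw. replace (w - RtoC 0) with w in * by ring.
apply Rmin_Rgt in Hw as [Hw Hw'].
apply Rmin_Rgt in Hw as [Hw1 Hw].
apply Rmin_Rgt in Hw as [Hw2 Hw3].
apply Rmin_Rgt in Hw' as [Hw4 Hw5].
destruct w as [x y].
set (M := Cmod (x, y)) in *.
assert (Hx : (Rabs x <= M)%R).
{ apply Rle_trans with (2 := Rmax_Cmod (x, y)), Rmax_l. }
assert (Hy : (Rabs y <= M)%R).
{ apply Rle_trans with (2 := Rmax_Cmod (x, y)), Rmax_r. }
specialize (He x ltac:(lra)); specialize (Hc y ltac:(lra)); specialize (Hs y ltac:(lra)).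
rewrite Rplus_0_l, Rmult_1_l in He.
rewrite cos_0, Rplus_0_l in Hc. rewrite sin_0, Rplus_0_l, Rmult_1_l, Rminus_0_r in Hs.
assert (He1 : (Rabs (exp x - 1 - x) <= eps / 8 * M)%R).
{ apply Rle_trans with (1 := He). apply Rmult_le_compat; try apply Rabs_pos; auto.
  - apply Rmin_glb; lra.
  - apply Rmin_l. }
assert (He2 : (Rabs (exp x - 1) <= 2 * M)%R).
{ replace (exp x - 1)%R with ((exp x - 1 - x) + x)%R by ring.
  apply Rle_trans with (1 := Rabs_triang _ _).
  assert (Rmin (eps / 8) 1 * Rabs x <= 1 * M)%R.
  { apply Rmult_le_compat; try apply Rabs_pos; auto.
    - apply Rmin_glb; lra.
    - apply Rmin_r. }
  lra. }
assert (Hex : (Rabs (exp x) <= 2)%R).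
{ replace (exp x) with ((exp x - 1) + 1)%R by ring.
  apply Rle_trans with (1 := Rabs_triang _ _). rewrite Rabs_R1. lra. }
assert (Hc1 : (Rabs (cos y - 1) <= eps / 16 * M)%R).
{ replace (cos y - 1)%R with (cos y - 1 - - 0 * y)%R by ring.
  apply Rle_trans with (1 := Hc). apply Rmult_le_compat_l; lra. }
assert (Hs1 : (Rabs (sin y - y) <= eps / 16 * M)%R).
{ apply Rle_trans with (1 := Hs). apply Rmult_le_compat_l; lra. }
rewrite Cexp_0.
(* The first three summands carry the first-order errors of exp, cos and sin; the last is of second
   order, which is why the radius is also bounded by [eps / 16]. Each is at most [eps * M / 8]. *)
replace (Cexp (x, y) - RtoC 1 - RtoC 1 * (x, y)) with
  (RtoC (exp x - 1 - x) + (RtoC (exp x * (cos y - 1)) +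
     (Ci * RtoC (exp x * (sin y - y)) + Ci * RtoC ((exp x - 1) * y)))).
2:{ apply injective_projections; simpl; ring. }
assert (HCi : Cmod Ci = 1%R).
{ unfold Cmod, Ci; simpl. replace (_ + _)%R with 1%R by ring. apply sqrt_1. }
assert (HM : (0 <= M)%R) by apply Cmod_ge_0.
eapply Rle_trans; [apply Cmod_triangle|].
eapply Rle_trans; [apply Rplus_le_compat_l, Cmod_triangle|].
eapply Rle_trans; [apply Rplus_le_compat_l, Rplus_le_compat_l, Cmod_triangle|].
rewrite !Cmod_mult, !HCi, !Cmod_R, !Rmult_1_l, !Rabs_mult.
assert (Rabs (exp x) * Rabs (cos y - 1) <= 2 * (eps / 16 * M))%R
  by (apply Rmult_le_compat; auto using Rabs_pos).
assert (Rabs (exp x) * Rabs (sin y - y) <= 2 * (eps / 16 * M))%R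
  by (apply Rmult_le_compat; auto using Rabs_pos).
assert (Rabs (exp x - 1) * Rabs y <= (2 * M) * (eps / 16))%R
  by (apply Rmult_le_compat; auto using Rabs_pos; lra).
assert (0 <= eps * M)%R by (apply Rmult_le_pos; lra).
lra.
Qed.

Lemma is_holo_derive_Cexp (z : C) : is_holo_derive Cexp z (Cexp z).
Proof.
assert (H0 : is_holo_derive (fun w => w + - z) z (RtoC 1 + RtoC 0)).
{ apply is_holo_derive_plus; [apply is_holo_derive_id|apply is_holo_derive_const]. }
assert (H1 : is_holo_derive (fun w => Cexp (w + - z)) z ((RtoC 1 + RtoC 0) * RtoC 1)).
{ apply (is_holo_derive_comp Cexp (fun w => w + - z)); [|exact H0].
  replace (z + - z) with (RtoC 0) by ring. exact is_holo_derive_Cexp_0. }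
apply (is_holo_derive_ext_loc (fun w => Cexp z * Cexp (w + - z))).
{ apply filter_forall; intros w. rewrite <- Cexp_plus. f_equal; ring. }
apply (is_holo_derive_eq _ _ _ _ (is_holo_derive_mult (fun _ => Cexp z) _ z _ _
  (is_holo_derive_const (Cexp z) z) H1)).
ring.
Qed.

(** * Complex power series *)

Notation is_Cseries := (is_series (K := C_AbsRing) (V := C_NormedModule)).

Lemma is_Cseries_norm_le (a : nat -> C) (b : nat -> R) (l : C) (L : R) :
  is_Cseries a l -> is_series b L -> (forall n, (Cmod (a n) <= b n)%R) ->
  (Cmod l <= L)%R.
Proof.
intros Ha Hb Hab.
assert (Hl : is_lim_seq (fun n => Cmod (sum_n (G := C_NormedModule) a n)) (Cmod l)).
{ apply (filterlim_comp _ _ _ _ (norm (V := C_NormedModule)) _ _ _ Ha).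
  apply (filterlim_norm (V := C_NormedModule) l). }
refine (is_lim_seq_le _ _ (Cmod l) L _ Hl Hb).
intros n.
eapply Rle_trans; [apply (norm_sum_n_m (V := C_NormedModule) a 0 n)|].
apply sum_n_m_le, Hab.
Qed.

Lemma is_Cseries_abs (a : nat -> C) :
  ex_series (fun n => Cmod (a n)) -> is_Cseries a (CSeries a).
Proof.
intros H.
destruct (ex_series_le (V := C_CompleteNormedModule) a (fun n => Cmod (a n))
  (fun n => Rle_refl _) H) as [l Hl].
rewrite (CSeries_unique a l Hl). exact Hl.
Qed.

Definition CPSeries (a : nat -> C) (w : C) : C := CSeries (fun k => a k * w ^ k).

(** Passing to moduli keeps the disc of convergence and makes the real theory of [CV_radius]
    applicable. *)
Definition CPS_radius (a : nat -> C) : Rbar := CV_radius (fun k => Cmod (a k)).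

Definition CPS_derive (a : nat -> C) (k : nat) : C := RtoC (INR (S k)) * a (S k).

Lemma is_Cseries_CPSeries (a : nat -> C) (w : C) :
  Rbar_lt (Cmod w) (CPS_radius a) ->
  is_Cseries (fun k => a k * w ^ k) (CPSeries a w).
Proof.
intros H. apply is_Cseries_abs.
generalize (CV_disk_inside (fun k => Cmod (a k)) (Cmod w)); intros HH.
apply (ex_series_ext (fun n => Rabs (Cmod (a n) * Cmod w ^ n))).
- intros n. rewrite Cmod_mult, Cmod_pow. apply Rabs_pos_eq.
  apply Rmult_le_pos; [apply Cmod_ge_0|apply pow_le, Cmod_ge_0].
- apply HH. rewrite Rabs_pos_eq; [exact H|apply Cmod_ge_0].
Qed.

Lemma Cmod_INR (n : nat) : Cmod (RtoC (INR n)) = INR n.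
Proof. rewrite Cmod_R. apply Rabs_pos_eq, pos_INR. Qed.

Lemma CPS_radius_derive (a : nat -> C) : CPS_radius (CPS_derive a) = CPS_radius a.
Proof.
unfold CPS_radius. rewrite <- (CV_radius_derive (fun k => Cmod (a k))).
apply CV_radius_ext; intros n. unfold CPS_derive, PS_derive.
rewrite Cmod_mult, Cmod_INR. reflexivity.
Qed.

(** If R n denotes the remainder for the exponent n, then [R (n+1) = w' R n + n w^(n-1) (w' - w)^2].
    The constant is twice the sharp one, but it is a coefficient of the second derivative, hence
    summable inside the disc. *)
Lemma Cmod_pow_taylor_le (w w' : C) (r : R) (k : nat) :
  (Cmod w <= r)%R -> (Cmod w' <= r)%R ->
  (Cmod (w' ^ S (S k) - w ^ S (S k) - (w' - w) * (RtoC (INR (S (S k))) * w ^ S k))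
    <= Cmod (w' - w) ^ 2 * (INR (S k) * INR (S (S k)) * r ^ k))%R.
Proof.
intros Hw Hw'.
assert (Hr : (0 <= r)%R) by (eapply Rle_trans; [apply Cmod_ge_0|exact Hw]).
set (h := Cmod (w' - w)).
induction k as [|k IH].
- replace (_ - _ - _) with ((w' - w) ^ 2).
  + rewrite Cmod_pow. fold h. simpl INR.
    assert (0 <= h ^ 2)%R by apply pow2_ge_0. simpl (r ^ 0)%R. nra.
  + simpl. rewrite RtoC_plus. ring.
- replace (w' ^ S (S (S k)) - w ^ S (S (S k)) -
      (w' - w) * (RtoC (INR (S (S (S k)))) * w ^ S (S k)))
    with (w' * (w' ^ S (S k) - w ^ S (S k) - (w' - w) * (RtoC (INR (S (S k))) * w ^ S k))
          + RtoC (INR (S (S k))) * w ^ S k * (w' - w) ^ 2).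
  2:{ rewrite (S_INR (S (S k))), RtoC_plus. simpl Cpow. ring. }
  eapply Rle_trans; [apply Cmod_triangle|].
  rewrite (Cmod_mult w'), (Cmod_mult (_ * _) (_ ^ 2)), (Cmod_mult (RtoC _)), !Cmod_pow, Cmod_INR. fold h.
  set (A := (h ^ 2 * (INR (S k) * INR (S (S k)) * r ^ k))%R) in *.
  apply Rle_trans with (r * A + INR (S (S k)) * r ^ S k * h ^ 2)%R.
  + apply Rplus_le_compat.
    * apply Rmult_le_compat; auto using Cmod_ge_0.
    * apply Rmult_le_compat_r; [apply pow2_ge_0|].
      apply Rmult_le_compat_l; [apply pos_INR|].
      apply pow_incr; split; [apply Cmod_ge_0|exact Hw].
  + unfold A. rewrite !S_INR.
    assert (H : (0 <= h ^ 2 * r ^ S k * (INR k + 1 + 1))%R).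
    { apply Rmult_le_pos; [apply Rmult_le_pos; [apply pow2_ge_0|apply pow_le, Hr]|].
      generalize (pos_INR k); lra. }
    simpl pow in *. nra.
Qed.

Lemma is_holo_derive_CPSeries (a : nat -> C) (w : C) :
  Rbar_lt (Cmod w) (CPS_radius a) ->
  is_holo_derive (CPSeries a) w (CPSeries (CPS_derive a) w).
Proof.
intros Hw.
assert (Hr : exists r : R, (Cmod w < r)%R /\ Rbar_lt r (CPS_radius a)).
{ destruct (CPS_radius a) as [s| |]; simpl in Hw |- *.
  - exists ((Cmod w + s) / 2)%R; lra.
  - exists (Cmod w + 1)%R; split; [lra|exact I].
  - contradiction. }
destruct Hr as [r [Hwr Hr]].
assert (Hw0 := Cmod_ge_0 w).
set (alpha := fun k => Cmod (a k)).
(* Terms at r of the second derivative of the series of moduli; [pred] makes those of index 0 and 1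
   vanish. Their sum B bounds the remainder by [B * Cmod (w' - w) ^ 2] for all w' in the disc of
   radius r. *)
set (t := fun k => (INR (pred k) * INR k * alpha k * r ^ (pred (pred k)))%R).
set (B := PSeries (PS_derive (PS_derive alpha)) r).
assert (Ht : is_series t B).
{ apply is_series_decr_1, is_series_decr_1.
  apply (is_series_ext (fun k => PS_derive (PS_derive alpha) k * r ^ k)%R).
  { intros k. unfold t, PS_derive. simpl pred.
    eq_in R. ring. }
  replace (plus _ _) with B.
  2:{ unfold t, plus, opp; simpl. ring. }
  apply Series_correct.
  apply (ex_series_Rabs (fun k => PS_derive (PS_derive alpha) k * r ^ k)%R).
  apply CV_disk_inside. rewrite !CV_radius_derive.
  rewrite Rabs_pos_eq by lra. exact Hr. }
assert (HB := Rabs_pos B).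
apply is_holo_derive_eps; intros eps Heps.
exists (Rmin (r - Cmod w) (eps / (Rabs B + 1))); split.
{ apply Rmin_pos; [lra|]. apply Rdiv_lt_0_compat; lra. }
intros w' Hw'. apply Rmin_Rgt in Hw' as [Hw1 Hw2].
assert (Hw'r : (Cmod w' < r)%R).
{ replace w' with ((w' - w) + w) by ring.
  eapply Rle_lt_trans; [apply Cmod_triangle|lra]. }
assert (Hw'R : Rbar_lt (Cmod w') (CPS_radius a)).
{ apply Rbar_lt_trans with (2 := Hr). exact Hw'r. }
assert (S1 := is_Cseries_CPSeries a w' Hw'R).
assert (S2 := is_Cseries_CPSeries a w Hw).
assert (S3 : is_Cseries (fun k => RtoC (INR k) * a k * w ^ pred k) (CPSeries (CPS_derive a) w)).
{ apply is_series_decr_1.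
  apply (is_series_ext (V := C_NormedModule) (fun k => CPS_derive a k * w ^ k)).
  { intros k. reflexivity. }
  replace (plus _ _) with (CPSeries (CPS_derive a) w).
  2:{ change (CPSeries (CPS_derive a) w =
        CPSeries (CPS_derive a) w + - (RtoC 0 * a O * RtoC 1)). ring. }
  apply is_Cseries_CPSeries. rewrite CPS_radius_derive. exact Hw. }
assert (S4 := is_series_minus _ _ _ _ (is_series_minus _ _ _ _ S1 S2)
  (is_series_scal (V := C_NormedModule) (w' - w) _ _ S3)).
assert (S5 := is_series_scal_l (K := R_AbsRing) (Cmod (w' - w) ^ 2)%R _ _ Ht).
rewrite (Cmult_comm (CPSeries (CPS_derive a) w)).
eapply Rle_trans.
{ refine (is_Cseries_norm_le _ _ _ _ S4 S5 _).
  intros n.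
  change (Cmod (a n * w' ^ n - a n * w ^ n - (w' - w) * (RtoC (INR n) * a n * w ^ pred n))
    <= Cmod (w' - w) ^ 2 * t n)%R.
  destruct n as [|[|k]].
  - unfold t. simpl.
    replace (_ - _ - _) with (RtoC 0) by ring. rewrite Cmod_0. lra.
  - unfold t. simpl.
    replace (_ - _ - _) with (RtoC 0) by ring. rewrite Cmod_0. lra.
  - replace (_ - _ - _) with (a (S (S k)) * (w' ^ S (S k) - w ^ S (S k) -
      (w' - w) * (RtoC (INR (S (S k))) * w ^ S k))) by (simpl pred; ring).
    rewrite Cmod_mult. unfold t. simpl pred.
    eapply Rle_trans.
    + apply Rmult_le_compat_l; [apply Cmod_ge_0|].
      apply (Cmod_pow_taylor_le w w' r k); lra.
    + unfold alpha. apply Req_le. ring. }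
change (Cmod (w' - w) ^ 2 * B <= eps * Cmod (w' - w))%R.
assert (H0 := Cmod_ge_0 (w' - w)).
assert (Hd : (Cmod (w' - w) * (Rabs B + 1) < eps)%R) by (apply Rlt_div_r; lra).
generalize (Rle_abs B). nra.
Qed.

(** * Functions [w^n * sum_k b_k w^k] of [w = exp(l tau)] *)

Lemma filterlim_Cconst {T} (F : (T -> Prop) -> Prop) {FF : Filter F} (c : C) :
  filterlim (fun _ => c) F (Clocally c).
Proof. exact (filterlim_const (U := AbsRing_UniformSpace C_AbsRing) c). Qed.

Lemma filterlim_Cplus {T} (F : (T -> Prop) -> Prop) {FF : Filter F} (f g : T -> C) (x y : C) :
  filterlim f F (Clocally x) -> filterlim g F (Clocally y) ->
  filterlim (fun t => f t + g t) F (Clocally (x + y)).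
Proof.
intros Hf Hg. apply (filterlim_comp_2 f g Cplus Hf Hg).
exact (filterlim_plus (V := AbsRing_NormedModule C_AbsRing) x y).
Qed.

Lemma filterlim_Cmult {T} (F : (T -> Prop) -> Prop) {FF : Filter F} (f g : T -> C) (x y : C) :
  filterlim f F (Clocally x) -> filterlim g F (Clocally y) ->
  filterlim (fun t => f t * g t) F (Clocally (x * y)).
Proof.
intros Hf Hg. apply (filterlim_comp_2 f g Cmult Hf Hg).
exact (filterlim_mult (K := C_AbsRing) x y).
Qed.

Lemma filterlim_Cdiv {T} (F : (T -> Prop) -> Prop) {FF : Filter F} (f g : T -> C) (x y : C) :
  y <> RtoC 0 -> filterlim f F (Clocally x) -> filterlim g F (Clocally y) ->
  filterlim (fun t => f t / g t) F (Clocally (x / y)).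
Proof.
intros Hy Hf Hg. apply filterlim_Cmult; [exact FF|exact Hf|].
apply (filterlim_comp _ _ _ g Cinv _ _ _ Hg).
apply (is_holo_derive_continuous Cinv y _ (is_holo_derive_inv y Hy)).
Qed.

Lemma filterlim_Cneq {T} (F : (T -> Prop) -> Prop) {FF : Filter F} (f : T -> C) (x y : C) :
  x <> y -> filterlim f F (Clocally x) -> F (fun t => f t <> y).
Proof.
intros Hxy Hf. apply (Hf (fun w => w <> y)).
assert (Hp : (0 < Cmod (y - x))%R).
{ apply Cmod_gt_0. intros H. apply Hxy. replace y with ((y - x) + x) by ring.
  rewrite H; ring. }
exists (mkposreal _ Hp). intros w Hw <-. exact (Rlt_irrefl _ Hw).
Qed.

#[export] Instance at_i_infty_filter : Filter at_i_infty.
Proof.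
split.
- exists 0%R; auto.
- intros P Q [Y HP] [Z HQ]. exists (Rmax Y Z). intros tau H.
  split; [apply HP|apply HQ]; (eapply Rle_lt_trans; [|exact H]);
    [apply Rmax_l|apply Rmax_r].
- intros P Q HPQ [Y HP]. exists Y; auto.
Qed.

Lemma CV_radius_le (a b : nat -> R) :
  (forall n, (Rabs (a n) <= Rabs (b n))%R) -> Rbar_le (CV_radius b) (CV_radius a).
Proof.
intros H. refine (is_lub_Rbar_subset _ _ _ _ _ (CV_radius_bounded a) (CV_radius_bounded b)).
intros x [M HM]. exists M. intros n. eapply Rle_trans; [|apply (HM n)].
rewrite !Rabs_mult. apply Rmult_le_compat_r; [apply Rabs_pos|apply H].
Qed.

(** Terms of a convergent series tend to 0, which is impossible outside the closed disc of
    convergence. Convergence of an expansion at one point thus yields a positive radius. *)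
Lemma is_Cseries_CPS_radius (a : nat -> C) (w l : C) :
  is_Cseries (fun k => a k * w ^ k) l -> Rbar_le (Cmod w) (CPS_radius a).
Proof.
intros H. apply Rbar_not_lt_le. intros Hlt.
rewrite <- (Rabs_pos_eq (Cmod w)) in Hlt by apply Cmod_ge_0.
apply (CV_disk_outside _ _ Hlt).
apply is_lim_seq_spec. intros eps.
destruct (Cauchy_ex_series (V := C_CompleteNormedModule) _ (ex_intro _ l H) eps) as [N HN].
exists N. intros n Hn. specialize (HN n n Hn Hn). rewrite sum_n_n in HN.
change (Cmod (a n * w ^ n) < eps)%R in HN.
rewrite Cmod_mult, Cmod_pow in HN.
rewrite Rminus_0_r, Rabs_pos_eq; [exact HN|].
apply Rmult_le_pos; [apply Cmod_ge_0|apply pow_le, Cmod_ge_0].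
Qed.

Definition qfun (l : C) (n : nat) (b : nat -> C) (tau : C) : C :=
  Cexp (l * tau) ^ n * CPSeries b (Cexp (l * tau)).

(** Differentiating [exp(l (n + k) tau)] multiplies it by [l (n + k)]. So derivatives of a [qfun]
    stay of the same form with the same n, and the leading coefficient is multiplied by [l n]. *)
Definition qcoef_derive (l : C) (n : nat) (b : nat -> C) (k : nat) : C :=
  l * RtoC (INR (n + k)) * b k.

(** The new coefficients are dominated by a multiple of [(1 + k) Cmod (b k)], the coefficients of
    [A(x) + x A'(x)] for the series A of moduli. *)
Lemma CPS_radius_qcoef_derive (l : C) (n : nat) (b : nat -> C) :
  Rbar_le (CPS_radius b) (CPS_radius (qcoef_derive l n b)).
Proof.
unfold CPS_radius.
set (alpha := fun k => Cmod (b k)).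
set (s := ((Cmod l + 1) * (INR n + 1))%R).
assert (Hl := Cmod_ge_0 l). assert (Hn := pos_INR n).
assert (Hs : (0 < s)%R) by (apply Rmult_lt_0_compat; lra).
apply Rbar_le_trans with
  (CV_radius (PS_scal s (PS_plus alpha (PS_incr_1 (PS_derive alpha))))).
- rewrite CV_radius_scal by lra.
  eapply Rbar_le_trans; [|apply CV_radius_plus].
  rewrite CV_radius_incr_1, CV_radius_derive.
  apply Rbar_min_case; apply Rbar_le_refl.
- apply CV_radius_le. intros k.
  replace (PS_scal s (PS_plus alpha (PS_incr_1 (PS_derive alpha))) k)
    with (s * ((1 + INR k) * alpha k))%R.
  2:{ unfold PS_scal, PS_plus, PS_incr_1, PS_derive, scal, plus, zero.
      destruct k; simpl; unfold mult; simpl.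
      - eq_in R; ring.
      - eq_in R; ring. }
  unfold qcoef_derive. rewrite !Cmod_mult, Cmod_INR. fold (alpha k).
  assert (Ha : (0 <= alpha k)%R) by apply Cmod_ge_0.
  assert (Hk := pos_INR k). rewrite plus_INR.
  rewrite !Rabs_pos_eq.
  + rewrite <- Rmult_assoc. apply Rmult_le_compat_r; [exact Ha|].
    unfold s. rewrite Rmult_assoc. apply Rmult_le_compat; nra.
  + repeat apply Rmult_le_pos; lra.
  + repeat apply Rmult_le_pos; lra.
Qed.

Lemma CPSeries_qcoef_derive (l : C) (n : nat) (b : nat -> C) (w : C) :
  Rbar_lt (Cmod w) (CPS_radius b) ->
  CPSeries (qcoef_derive l n b) w =
  l * (RtoC (INR n) * CPSeries b w + w * CPSeries (CPS_derive b) w).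
Proof.
intros Hw.
assert (S1 := is_Cseries_CPSeries b w Hw).
assert (S2 : is_Cseries (fun k => RtoC (INR k) * b k * w ^ k)
               (w * CPSeries (CPS_derive b) w)).
{ apply is_series_decr_1.
  apply (is_series_ext (V := C_NormedModule) (fun k => w * (CPS_derive b k * w ^ k))).
  { intros k. unfold CPS_derive.
    eq_in C. simpl Cpow. ring. }
  replace (plus _ _) with (w * CPSeries (CPS_derive b) w).
  2:{ change (w * CPSeries (CPS_derive b) w =
        w * CPSeries (CPS_derive b) w + - (RtoC 0 * b O * RtoC 1)). ring. }
  apply (is_series_scal (V := C_NormedModule)), is_Cseries_CPSeries.
  rewrite CPS_radius_derive. exact Hw. }
apply CSeries_unique.
apply (is_series_ext (V := C_NormedModule)
  (fun k => l * (RtoC (INR n) * (b k * w ^ k) + RtoC (INR k) * b k * w ^ k))).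
{ intros k. unfold qcoef_derive. rewrite plus_INR, RtoC_plus.
  eq_in C. ring. }
apply (is_series_scal (V := C_NormedModule)).
apply (is_series_plus (V := C_NormedModule)); [|exact S2].
apply (is_series_scal (V := C_NormedModule)); exact S1.
Qed.

Lemma is_holo_derive_Cexp_scal (l tau : C) :
  is_holo_derive (fun t => Cexp (l * t)) tau (l * Cexp (l * tau)).
Proof.
apply (is_holo_derive_comp Cexp (fun t => l * t)); [apply is_holo_derive_Cexp|].
apply (is_holo_derive_eq _ _ _ _ (is_holo_derive_mult (fun _ => l) (fun t => t) tau _ _
  (is_holo_derive_const l tau) (is_holo_derive_id tau))).
ring.
Qed.

Lemma is_holo_derive_qfun (l : C) (n : nat) (b : nat -> C) (tau : C) :
  Rbar_lt (Cmod (Cexp (l * tau))) (CPS_radius b) ->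
  is_holo_derive (qfun l n b) tau (qfun l n (qcoef_derive l n b) tau).
Proof.
intros H. unfold qfun.
assert (H1 : is_holo_derive (fun t => Cexp (l * t) ^ n) tau
               (RtoC (INR n) * l * Cexp (l * tau) ^ n)).
{ apply (is_holo_derive_ext_loc (fun t => Cexp (RtoC (INR n) * l * t))).
  { apply filter_forall; intros t. rewrite Cexp_pow. f_equal; ring. }
  rewrite Cexp_pow, Cmult_assoc. apply is_holo_derive_Cexp_scal. }
assert (H2 := is_holo_derive_comp (CPSeries b) (fun t => Cexp (l * t)) tau _ _
  (is_holo_derive_CPSeries b _ H) (is_holo_derive_Cexp_scal l tau)).
apply (is_holo_derive_eq _ _ _ _ (is_holo_derive_mult _ _ _ _ _ H1 H2)).
rewrite CPSeries_qcoef_derive by exact H. ring.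
Qed.

Lemma filterlim_CPSeries {T} (F : (T -> Prop) -> Prop) (w : T -> C) (b : nat -> C) :
  Rbar_lt 0 (CPS_radius b) -> filterlim w F (Clocally (RtoC 0)) ->
  filterlim (fun t => CPSeries b (w t)) F (Clocally (b O)).
Proof.
intros Hb Hw.
assert (Hb0 : Rbar_lt (Cmod (RtoC 0)) (CPS_radius b)) by (rewrite Cmod_0; exact Hb).
replace (b O) with (CPSeries b (RtoC 0)).
- apply (filterlim_comp _ _ _ w (CPSeries b) _ _ _ Hw).
  apply (is_holo_derive_continuous _ _ _ (is_holo_derive_CPSeries b _ Hb0)).
- apply CSeries_unique. apply is_series_decr_1.
  apply (is_series_ext (V := C_NormedModule) (fun _ => RtoC 0 * RtoC 0)).
  { intros k. eq_in C. simpl Cpow. ring. }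
  replace (plus _ _) with (RtoC 0 * b O).
  2:{ change (RtoC 0 * b O = b O + - (b O * RtoC 1)). ring. }
  apply (is_series_ext (V := C_NormedModule) (fun k => RtoC 0 * (b k * (RtoC 0) ^ k))).
  { intros k. eq_in C. ring. }
  replace (RtoC 0 * b O) with (RtoC 0 * CPSeries b (RtoC 0)) by ring.
  apply (is_series_scal (V := C_NormedModule)), is_Cseries_CPSeries, Hb0.
Qed.

(** The Schwarzian with [(f''/f')'] expanded: [f'''/f' - (f''/f')^2] minus half of [(f''/f')^2]. *)
Definition schwarzian_of_jet (d1 d2 d3 : C) : C :=
  d3 / d1 - RtoC (3 / 2) * (d2 / d1) ^ 2.

Definition has_jet (D : C -> Prop) (f f1 f2 f3 : C -> C) : Prop :=
  forall z, D z -> is_holo_derive f z (f1 z) /\ is_holo_derive f1 z (f2 z) /\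
    is_holo_derive f2 z (f3 z) /\ f1 z <> RtoC 0.

(** The common factor [Cexp (l tau) ^ n] cancels in the quotients of derivatives, leaving power
    series whose ratios tend to [l n] and [(l n)^2]; the Schwarzian tends to [(1 - 3/2) (l n)^2]. *)
Lemma qfun_jet (l : C) (n : nat) (b : nat -> C) :
  l <> RtoC 0 -> (0 < n)%nat -> b O <> RtoC 0 -> Rbar_lt 0 (CPS_radius b) ->
  filterlim (fun tau => Cexp (l * tau)) at_i_infty (Clocally (RtoC 0)) ->
  exists f1 f2 f3 : C -> C,
    at_i_infty (fun tau => qfun l n b tau <> RtoC 0) /\
    (exists Y : R, has_jet (fun tau => (Y < Im tau)%R) (qfun l n b) f1 f2 f3) /\
    filterlim (qfun l n b) at_i_infty (Clocally (RtoC 0)) /\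
    filterlim (fun tau => schwarzian_of_jet (f1 tau) (f2 tau) (f3 tau)) at_i_infty
      (Clocally (- RtoC (/ 2) * (l * RtoC (INR n)) ^ 2)).
Proof.
intros Hl Hn Hb0 Hr Hw.
assert (Hn0 : RtoC (INR n) <> RtoC 0).
{ intros H. apply RtoC_inj in H. apply (not_0_INR n); [lia|exact H]. }
set (b1 := qcoef_derive l n b). set (b2 := qcoef_derive l n b1).
set (b3 := qcoef_derive l n b2).
assert (Hr1 : forall x, Rbar_lt x (CPS_radius b) -> Rbar_lt x (CPS_radius b1))
  by (intros x Hx; eapply Rbar_lt_le_trans; [exact Hx|apply CPS_radius_qcoef_derive]).
assert (Hr2 : forall x, Rbar_lt x (CPS_radius b1) -> Rbar_lt x (CPS_radius b2))
  by (intros x Hx; eapply Rbar_lt_le_trans; [exact Hx|apply CPS_radius_qcoef_derive]).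
assert (Hr3 : forall x, Rbar_lt x (CPS_radius b2) -> Rbar_lt x (CPS_radius b3))
  by (intros x Hx; eapply Rbar_lt_le_trans; [exact Hx|apply CPS_radius_qcoef_derive]).
assert (L0 := filterlim_CPSeries at_i_infty _ b Hr Hw).
assert (L1 := filterlim_CPSeries at_i_infty _ b1 (Hr1 _ Hr) Hw).
assert (L2 := filterlim_CPSeries at_i_infty _ b2 (Hr2 _ (Hr1 _ Hr)) Hw).
assert (L3 := filterlim_CPSeries at_i_infty _ b3 (Hr3 _ (Hr2 _ (Hr1 _ Hr))) Hw).
assert (E1 : b1 O = l * RtoC (INR n) * b O)
  by (unfold b1, qcoef_derive; rewrite Nat.add_0_r; reflexivity).
assert (E2 : b2 O = l * RtoC (INR n) * b1 O)
  by (unfold b2, qcoef_derive; rewrite Nat.add_0_r; reflexivity).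
assert (E3 : b3 O = l * RtoC (INR n) * b2 O)
  by (unfold b3, qcoef_derive; rewrite Nat.add_0_r; reflexivity).
assert (Hb1 : b1 O <> RtoC 0) by (rewrite E1; repeat apply Cmult_neq_0; assumption).
assert (Hwr : at_i_infty (fun tau => Rbar_lt (Cmod (Cexp (l * tau))) (CPS_radius b))).
{ apply (Hw (fun w => Rbar_lt (Cmod w) (CPS_radius b))). destruct (CPS_radius b) as [r| |]; simpl in Hr.
  - exists (mkposreal r Hr). intros w H.
    change (Cmod (w - RtoC 0) < r)%R in H.
    unfold Cminus in H. rewrite Copp_0, Cplus_0_r in H. exact H.
  - apply filter_forall. intros w; exact I.
  - contradiction. }
assert (N1 := filterlim_Cneq _ _ _ _ Hb1 L1).
assert (Hpow : forall tau, Cexp (l * tau) ^ n <> RtoC 0).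
{ intros tau. rewrite Cexp_pow. apply Cexp_neq_0. }
exists (qfun l n b1), (qfun l n b2), (qfun l n b3). split; [|split; [|split]].
- generalize (filterlim_Cneq _ _ _ _ Hb0 L0). apply filter_imp.
  intros tau H. apply Cmult_neq_0; [apply Hpow|exact H].
- destruct (filter_and _ _ Hwr N1) as [Y HY]. exists Y.
  intros tau Htau. destruct (HY tau Htau) as [H1 H2].
  repeat split; try (apply is_holo_derive_qfun; auto).
  apply Cmult_neq_0; [apply Hpow|exact H2].
- replace (RtoC 0) with (RtoC 0 * (RtoC 0) ^ pred n * b O) by ring.
  unfold qfun.
  apply filterlim_Cmult; [exact _| |exact L0].
  destruct n as [|n]; [lia|]. simpl Cpow. simpl pred.
  apply filterlim_Cmult; [exact _|exact Hw|].
  clear - Hw. induction n as [|n IH]; simpl Cpow.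
  + apply filterlim_Cconst, _.
  + apply filterlim_Cmult; [exact _|exact Hw|exact IH].
- replace (- RtoC (/ 2) * (l * RtoC (INR n)) ^ 2)
    with (b3 O / b1 O + RtoC (- (3 / 2)) * ((b2 O / b1 O) * (b2 O / b1 O))).
  2:{ rewrite E3, E2, E1. replace (RtoC (- (3 / 2))) with (- RtoC (/ 2) - RtoC 1).
      - field. repeat split; assumption.
      - rewrite <- RtoC_opp, <- RtoC_minus. f_equal. field. }
  apply (filterlim_ext (fun tau =>
    CPSeries b3 (Cexp (l * tau)) / CPSeries b1 (Cexp (l * tau)) + RtoC (- (3 / 2)) *
    ((CPSeries b2 (Cexp (l * tau)) / CPSeries b1 (Cexp (l * tau))) *
     (CPSeries b2 (Cexp (l * tau)) / CPSeries b1 (Cexp (l * tau)))))).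
  { intros tau. unfold schwarzian_of_jet, qfun.
    (* With the convention [/ 0 = 0] the cancellation holds even when the denominator vanishes, so
       the two functions agree at every tau. *)
    assert (Hc : forall x y, (Cexp (l * tau) ^ n * x) / (Cexp (l * tau) ^ n * y) = x / y).
    { intros x y. destruct (Ceq_dec y (RtoC 0)) as [->|Hy].
      - rewrite Cmult_0_r. unfold Cdiv.
        assert (H0 : / RtoC 0 = RtoC 0) by (apply injective_projections; simpl; unfold Rdiv; ring).
        rewrite H0. ring.
      - field. split; [exact Hy|apply Hpow]. }
    rewrite !Hc. rewrite RtoC_opp. simpl Cpow. ring. }
  apply filterlim_Cplus; [exact _| |].
  + apply filterlim_Cdiv; auto with typeclass_instances.
  + apply filterlim_Cmult; [exact _|apply filterlim_Cconst, _|].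
    apply filterlim_Cmult; [exact _| |]; apply filterlim_Cdiv; auto with typeclass_instances.
Qed.

(** * Schwarzian derivatives *)

Lemma is_holo_derive_unique (f : C -> C) (z l : C) :
  is_holo_derive f z l -> C_derive f z = l.
Proof. intros H. apply is_C_derive_unique, is_holo_derive_C, H. Qed.

Definition Copen (D : C -> Prop) : Prop := forall z, D z -> Clocally z D.

(** Openness is essential: a second [C_derive] can be computed only once the first is known on a
    neighbourhood, not merely at z. *)
Lemma schwarzian_has_jet (D : C -> Prop) (f f1 f2 f3 g : C -> C) (z : C) :
  Copen D -> has_jet D f f1 f2 f3 -> (forall w, D w -> g w = f w) -> D z ->
  C_derive g z <> RtoC 0 /\
  schwarzian g z = schwarzian_of_jet (f1 z) (f2 z) (f3 z).
Proof.
intros HD Hj Hg Hz.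
assert (D1 : forall w, D w -> C_derive g w = f1 w).
{ intros w Hw. apply is_holo_derive_unique.
  apply (is_holo_derive_ext_loc f); [|apply Hj, Hw].
  generalize (HD w Hw). apply filter_imp. intros t Ht. symmetry; auto. }
assert (D2 : forall w, D w -> C_derive (C_derive g) w = f2 w).
{ intros w Hw. apply is_holo_derive_unique.
  apply (is_holo_derive_ext_loc f1); [|apply Hj, Hw].
  generalize (HD w Hw). apply filter_imp. intros t Ht. symmetry; auto. }
destruct (Hj z Hz) as [_ [J1 [J2 J0]]].
split; [rewrite D1; assumption|].
unfold schwarzian, schwarzian_of_jet.
rewrite (is_holo_derive_unique _ z ((f3 z * f1 z - f2 z * f2 z) / (f1 z * f1 z))).
- rewrite D1, D2 by exact Hz.
  replace (RtoC (3 / 2)) with (RtoC 1 + RtoC (/ 2))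
    by (rewrite <- RtoC_plus; f_equal; field).
  field. exact J0.
- apply (is_holo_derive_ext_loc (fun w => f2 w / f1 w)).
  + generalize (HD z Hz). apply filter_imp. intros t Ht. rewrite D1, D2 by exact Ht.
    reflexivity.
  + apply is_holo_derive_div; assumption.
Qed.

Lemma has_jet_mobius (D : C -> Prop) (f f1 f2 f3 : C -> C) (p q r s : C) :
  p * s - q * r <> RtoC 0 -> has_jet D f f1 f2 f3 ->
  (forall z, D z -> r * f z + s <> RtoC 0) ->
  exists g1 g2 g3 : C -> C,
    has_jet D (fun z => (p * f z + q) / (r * f z + s)) g1 g2 g3 /\
    forall z, D z ->
      schwarzian_of_jet (g1 z) (g2 z) (g3 z) = schwarzian_of_jet (f1 z) (f2 z) (f3 z).
Proof.
intros Hdet Hj Hv.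
set (d := p * s - q * r) in *.
set (v := fun z => r * f z + s).
(* Quotient rule with [v' = r f']: one factor v cancels at each of the later differentiations, so
   the denominators are [v^2], [v^3], [v^4], and the first derivative keeps the nonzero numerator
   [d f']. *)
exists (fun z => d * f1 z / (v z * v z)),
  (fun z => d * (f2 z * v z - RtoC 2 * r * (f1 z * f1 z)) / (v z * v z * v z)),
  (fun z => d * (f3 z * (v z * v z) - RtoC 6 * r * (f1 z * f2 z * v z) +
                 RtoC 6 * (r * r) * (f1 z * f1 z * f1 z)) / (v z * v z * v z * v z)).
assert (E2 : RtoC 2 = RtoC 1 + RtoC 1) by (rewrite <- RtoC_plus; f_equal; ring).
assert (E3 : RtoC 3 = RtoC 1 + RtoC 1 + RtoC 1) by (rewrite <- !RtoC_plus; f_equal; ring).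
assert (E6 : RtoC 6 = RtoC 2 * RtoC 3) by (rewrite <- RtoC_mult; f_equal; ring).
split.
- intros z Hz. destruct (Hj z Hz) as [J0 [J1 [J2 N1]]]. specialize (Hv z Hz).
  assert (Hmul : forall (c : C) (u : C -> C) (u' : C), is_holo_derive u z u' ->
    is_holo_derive (fun w => c * u w) z (c * u')).
  { intros c u u' Hu. apply (is_holo_derive_eq _ _ _ _ (is_holo_derive_mult _ _ _ _ _
      (is_holo_derive_const c z) Hu)). ring. }
  assert (Hadd : forall (c : C) (u : C -> C) (u' : C), is_holo_derive u z u' ->
    is_holo_derive (fun w => u w + c) z u').
  { intros c u u' Hu. apply (is_holo_derive_eq _ _ _ _ (is_holo_derive_plus _ _ _ _ _
      Hu (is_holo_derive_const c z))). ring. }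
  assert (Jv : is_holo_derive v z (r * f1 z)) by (apply Hadd, Hmul, J0).
  assert (Jvv := is_holo_derive_mult _ _ _ _ _ Jv Jv).
  assert (Jvvv := is_holo_derive_mult _ _ _ _ _ Jvv Jv).
  fold (v z) in Hv.
  split; [|split; [|split]].
  + apply (is_holo_derive_eq _ _ _ _ (is_holo_derive_div (fun z => p * f z + q) v z _ _ Hv
      (Hadd _ _ _ (Hmul _ _ _ J0)) Jv)).
    unfold d, v in *. field. exact Hv.
  + refine (is_holo_derive_eq _ _ _ _ (is_holo_derive_div _ _ z _ _ _
      (Hmul _ _ _ J1) Jvv) _).
    * apply Cmult_neq_0; exact Hv.
    * simpl. rewrite E2. field. exact Hv.
  + assert (Jn := is_holo_derive_plus _ _ _ _ _ (is_holo_derive_mult _ _ _ _ _ J2 Jv)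
      (Hmul (- (RtoC 2 * r)) _ _ (is_holo_derive_mult _ _ _ _ _ J1 J1))).
    assert (Jq := is_holo_derive_div _ _ z _ _
      (Cmult_neq_0 _ _ (Cmult_neq_0 _ _ Hv Hv) Hv) (Hmul d _ _ Jn) Jvvv).
    eapply is_holo_derive_eq.
    * eapply is_holo_derive_ext_loc; [|exact Jq].
      apply filter_forall. intros t. cbv beta. f_equal. ring.
    * cbv beta. rewrite E6, E3, E2. field. exact Hv.
  + unfold Cdiv. repeat apply Cmult_neq_0; auto.
    intros H. apply (Cmult_neq_0 _ _ Hv Hv).
    assert (H1 : (v z * v z) * / (v z * v z) = RtoC 1)
      by (field; exact Hv).
    rewrite H, Cmult_0_r in H1. exfalso. apply RtoC_inj in H1. lra.
- intros z Hz. destruct (Hj z Hz) as [_ [_ [_ N1]]]. specialize (Hv z Hz). fold (v z) in Hv.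
  unfold schwarzian_of_jet. replace (RtoC (3 / 2)) with (RtoC 3 * RtoC (/ 2))
    by (rewrite <- RtoC_mult; f_equal; field).
  assert (E : RtoC (/ 2) = / RtoC 2) by (apply RtoC_inv; lra).
  assert (N2 : RtoC 2 <> RtoC 0) by (intros H; apply RtoC_inj in H; lra).
  rewrite E, E6, E3. rewrite E2 in N2 |- *. field. repeat split; assumption.
Qed.

(** Chain rule [{f o i, z} = {f, i(z)} i'(z)^2 + {i, z}] for [i(z) = -1/z]: the last term vanishes
    as i is a Moebius map, and [i'(z) = 1 / z^2]. *)
Lemma has_jet_inversion (D : C -> Prop) (f f1 f2 f3 : C -> C) :
  has_jet D f f1 f2 f3 ->
  exists g1 g2 g3 : C -> C,
    has_jet (fun z => z <> RtoC 0 /\ D (RtoC (-1) / z)) (fun z => f (RtoC (-1) / z)) g1 g2 g3 /\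
    forall z, z <> RtoC 0 -> D (RtoC (-1) / z) ->
      schwarzian_of_jet (g1 z) (g2 z) (g3 z) =
      schwarzian_of_jet (f1 (RtoC (-1) / z)) (f2 (RtoC (-1) / z)) (f3 (RtoC (-1) / z)) / z ^ 4.
Proof.
intros Hj.
set (i := fun z : C => RtoC (-1) / z).
exists (fun z => f1 (i z) / (z * z)),
  (fun z => (f2 (i z) - RtoC 2 * (z * f1 (i z))) / (z * z * (z * z))),
  (fun z => (f3 (i z) - RtoC 6 * (z * f2 (i z)) + RtoC 6 * (z * z * f1 (i z))) /
            (z * z * (z * z) * (z * z))).
assert (E2 : RtoC 2 = RtoC 1 + RtoC 1) by (rewrite <- RtoC_plus; f_equal; ring).
assert (E3 : RtoC 3 = RtoC 1 + RtoC 1 + RtoC 1) by (rewrite <- !RtoC_plus; f_equal; ring).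
assert (E6 : RtoC 6 = RtoC 2 * RtoC 3) by (rewrite <- RtoC_mult; f_equal; ring).
assert (Em : RtoC (-1) = - RtoC 1) by (rewrite <- RtoC_opp; f_equal; ring).
split.
- intros z [Hz HDz]. fold (i z) in HDz. destruct (Hj (i z) HDz) as [J0 [J1 [J2 N1]]].
  assert (Hmul : forall (c : C) (u : C -> C) (u' : C), is_holo_derive u z u' ->
    is_holo_derive (fun w => c * u w) z (c * u')).
  { intros c u u' Hu. apply (is_holo_derive_eq _ _ _ _ (is_holo_derive_mult _ _ _ _ _
      (is_holo_derive_const c z) Hu)). ring. }
  assert (Ji : is_holo_derive i z (/ (z * z))).
  { apply (is_holo_derive_eq _ _ _ _ (is_holo_derive_div _ _ z _ _ Hz
      (is_holo_derive_const (RtoC (-1)) z) (is_holo_derive_id z))).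
    rewrite Em. field. exact Hz. }
  assert (Jz := is_holo_derive_id z).
  assert (Jzz := is_holo_derive_mult _ _ _ _ _ Jz Jz).
  assert (Jz4 := is_holo_derive_mult _ _ _ _ _ Jzz Jzz).
  assert (C0 := is_holo_derive_comp f i z _ _ J0 Ji).
  assert (C1 := is_holo_derive_comp f1 i z _ _ J1 Ji).
  assert (C2 := is_holo_derive_comp f2 i z _ _ J2 Ji).
  assert (Hzz := Cmult_neq_0 _ _ Hz Hz).
  split; [|split; [|split]].
  + apply (is_holo_derive_eq _ _ _ _ C0). field. exact Hz.
  + apply (is_holo_derive_eq _ _ _ _ (is_holo_derive_div _ (fun w => w * w) z _ _ Hzz C1 Jzz)).
    cbv beta. rewrite E2. field. exact Hz.
  + assert (Jn := is_holo_derive_plus _ _ _ _ _ C2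
      (Hmul (- RtoC 2) _ _ (is_holo_derive_mult _ _ _ _ _ Jz C1))).
    assert (Jq := is_holo_derive_div _ (fun w => w * w * (w * w)) z _ _ (Cmult_neq_0 _ _ Hzz Hzz) Jn Jz4).
    eapply is_holo_derive_eq.
    * eapply is_holo_derive_ext_loc; [|exact Jq].
      apply filter_forall. intros t. cbv beta. f_equal. ring.
    * cbv beta. rewrite E6, E3, E2. field. exact Hz.
  + intros H. apply N1. fold (i z) in *.
    replace (f1 (i z)) with (f1 (i z) / (z * z) * (z * z)) by (field; exact Hz).
    rewrite H. ring.
- intros z Hz HDz. fold (i z) in *. destruct (Hj (i z) HDz) as [_ [_ [_ N1]]].
  unfold schwarzian_of_jet. replace (RtoC (3 / 2)) with (RtoC 3 * RtoC (/ 2))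
    by (rewrite <- RtoC_mult; f_equal; field).
  assert (E : RtoC (/ 2) = / RtoC 2) by (apply RtoC_inv; lra).
  assert (N2 : RtoC 2 <> RtoC 0) by (intros H; apply RtoC_inj in H; lra).
  rewrite E, E6, E3. rewrite E2 in N2 |- *. field. repeat split; assumption.
Qed.

(** * q-expansions and the Schwarzian at a cusp *)

Lemma q_expansion_jet (f : C -> P1) (m n : nat) (c : Z -> C) :
  (0 < m)%nat -> (0 < n)%nat -> c (Z.of_nat n) <> RtoC 0 ->
  has_q_expansion m (Z.of_nat n) c f ->
  exists f0 f1 f2 f3 : C -> C,
    at_i_infty (fun tau => f tau = Fin (f0 tau) /\ f0 tau <> RtoC 0) /\
    (exists Y : R, has_jet (fun tau => (Y < Im tau)%R) f0 f1 f2 f3) /\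
    filterlim f0 at_i_infty (Clocally (RtoC 0)) /\
    filterlim (fun tau => schwarzian_of_jet (f1 tau) (f2 tau) (f3 tau)) at_i_infty
      (Clocally (RtoC 2 * RtoC PI ^ 2 * (RtoC (INR n) / RtoC (INR m)) ^ 2)).
Proof.
intros Hm Hn Hc Hq.
assert (Hm0 : (0 < INR m)%R) by (apply lt_0_INR; exact Hm).
assert (HmC : RtoC (INR m) <> RtoC 0) by (intros H; apply RtoC_inj in H; lra).
assert (HPI := PI_RGT_0).
set (r := (2 * PI / INR m)%R).
assert (Hr : (0 < r)%R) by (apply Rdiv_lt_0_compat; lra).
set (l := RtoC r * Ci).
(* Coefficients left after taking out the n-th power of [Cexp (l * tau)]; the constant term is the
   nonzero leading coefficient of the expansion. *)
set (b := fun j : nat => c (Z.of_nat n + Z.of_nat j)%Z).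
assert (Hre : forall tau, Cmod (Cexp (l * tau)) = exp (- (r * Im tau))).
{ intros tau. rewrite Cmod_Cexp. f_equal. unfold l, Re, Im; simpl. ring. }
destruct Hq as [Y HY].
assert (HY' : forall tau, (Y < Im tau)%R -> exists z, f tau = Fin z /\
  is_Cseries (fun j => b j * Cexp (l * tau) ^ j) (z / Cexp (l * tau) ^ n)).
{ intros tau Htau. destruct (HY tau Htau) as [z [Hz Hs]]. exists z; split; [exact Hz|].
  assert (Hp : Cexp (l * tau) ^ n <> RtoC 0) by (rewrite Cexp_pow; apply Cexp_neq_0).
  unfold Cdiv. rewrite (Cmult_comm z).
  apply (is_series_ext (V := C_NormedModule) (fun j => / (Cexp (l * tau) ^ n) *
    (b j * (Cexp (l * tau) ^ n * Cexp (l * tau) ^ j)))).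
  { intros j. eq_in C.
    revert Hp. generalize (Cexp (l * tau) ^ n), (Cexp (l * tau) ^ j). intros u v Hu.
    field. exact Hu. }
  apply (is_series_scal (V := C_NormedModule)).
  apply (is_series_ext (V := C_NormedModule)) with (2 := Hs).
  intros j. fold (b j). eq_in C. f_equal.
  rewrite !Cexp_pow, <- Cexp_plus. f_equal.
  rewrite <- Nat2Z.inj_add, <- INR_IZR_INZ, plus_INR, RtoC_plus.
  unfold l, r. rewrite RtoC_div, RtoC_mult by lra. field. exact HmC. }
assert (Hrad : forall tau, (Y < Im tau)%R -> Rbar_le (Cmod (Cexp (l * tau))) (CPS_radius b)).
{ intros tau Htau. destruct (HY' tau Htau) as [z [_ Hz]].
  exact (is_Cseries_CPS_radius _ _ _ Hz). }
(* One point of the half-plane of convergence is enough, because [Cexp] never vanishes there. *)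
assert (Hrad0 : Rbar_lt 0 (CPS_radius b)).
{ apply Rbar_lt_le_trans with (2 := Hrad (0, Y + 1)%R ltac:(simpl; lra)).
  rewrite Hre. apply exp_pos. }
assert (Hw : filterlim (fun tau => Cexp (l * tau)) at_i_infty (Clocally (RtoC 0))).
{ intros P [eps HP].
  exists (- ln eps / r)%R. intros tau Htau. apply HP.
  change (Cmod (Cexp (l * tau) - RtoC 0) < eps)%R.
  replace (Cexp (l * tau) - RtoC 0) with (Cexp (l * tau)) by ring.
  rewrite Hre, <- (exp_ln eps) by apply cond_pos. apply exp_increasing.
  apply Rlt_div_l in Htau; lra. }
assert (Hl : l <> RtoC 0).
{ intros H. apply (f_equal Im) in H. unfold l in H; simpl in H. lra. }
assert (Hb : b O <> RtoC 0) by (unfold b; rewrite Z.add_0_r; exact Hc).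
destruct (qfun_jet l n b Hl Hn Hb Hrad0 Hw) as [f1 [f2 [f3 [H0 [HJ [HL HS]]]]]].
exists (qfun l n b), f1, f2, f3. split; [|split; [exact HJ|split; [exact HL|]]].
- assert (HF : at_i_infty (fun tau => f tau = Fin (qfun l n b tau))).
  { exists (Y + 1)%R. intros tau Htau.
    destruct (HY' tau ltac:(lra)) as [z [Hz Hs]]. rewrite Hz. f_equal.
    assert (HC : CPSeries b (Cexp (l * tau)) = z / Cexp (l * tau) ^ n)
      by (apply CSeries_unique, Hs).
    unfold qfun. rewrite HC.
    assert (Hp : Cexp (l * tau) ^ n <> RtoC 0) by (rewrite Cexp_pow; apply Cexp_neq_0).
    revert Hp. generalize (Cexp (l * tau) ^ n). intros u Hu. field. exact Hu. }
  exact (filter_and _ _ HF H0).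
- replace (RtoC 2 * RtoC PI ^ 2 * (RtoC (INR n) / RtoC (INR m)) ^ 2)
    with (- RtoC (/ 2) * (l * RtoC (INR n)) ^ 2); [exact HS|].
  unfold l, r. rewrite RtoC_div, RtoC_mult, RtoC_inv by lra.
  assert (HCi : Ci * Ci = - RtoC 1) by (apply injective_projections; simpl; ring).
  transitivity (- (Ci * Ci) * RtoC 2 * RtoC PI ^ 2 * (RtoC (INR n) / RtoC (INR m)) ^ 2).
  + field. exact HmC.
  + rewrite HCi. ring.
Qed.

Lemma mobius_Fin_inv (g : mat2 C) (p : P1) (w : C) :
  GL2C g -> mobius g p = Fin w -> m11 g - m21 g * w <> RtoC 0 ->
  p = Fin ((m22 g * w - m12 g) / (m11 g - m21 g * w)).
Proof.
destruct g as [A B K D]; unfold GL2C; simpl. intros Hdet Hp Hw.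
destruct p as [z|]; simpl in Hp.
- destruct (Ceq_dec (K * z + D) (RtoC 0)) as [H|H]; [discriminate|].
  injection Hp as <-. f_equal.
  assert (Hd : A - K * ((A * z + B) / (K * z + D)) = (A * D - B * K) / (K * z + D))
    by (field; exact H).
  rewrite Hd. field. split; assumption.
(* The image of infinity is [A / K], exactly the value at which the denominator of the inverse map
   vanishes. *)
- exfalso. destruct (Ceq_dec K (RtoC 0)) as [H|H]; [discriminate|].
  injection Hp as <-. apply Hw. field. exact H.
Qed.

Lemma ramification_jet (f : C -> P1) (m n : nat) :
  (0 < m)%nat -> ramification_at_i_infty f m n ->
  exists (Y : R) (f0 f1 f2 f3 : C -> C),
    (forall tau, (Y < Im tau)%R -> f tau = Fin (f0 tau)) /\
    has_jet (fun tau => (Y < Im tau)%R) f0 f1 f2 f3 /\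
    filterlim (fun tau => schwarzian_of_jet (f1 tau) (f2 tau) (f3 tau)) at_i_infty
      (Clocally (RtoC 2 * RtoC PI ^ 2 * (RtoC (INR n) / RtoC (INR m)) ^ 2)).
Proof.
intros Hm [Hn [g [Hg [_ [c [Hc Hq]]]]]].
destruct (q_expansion_jet _ m n c Hm Hn Hc Hq)
  as [w [w1 [w2 [w3 [Hw [[Y1 HJ] [HL HS]]]]]]].
(* If [m11 g] is nonzero, the denominator tends to it. If it is zero, the cusp is sent to infinity
   by f; then [m21 g] is nonzero by invertibility, and w, though tending to 0, has no zeros near the
   cusp. *)
assert (Hden : at_i_infty (fun tau => m11 g - m21 g * w tau <> RtoC 0)).
{ destruct (Ceq_dec (m11 g) (RtoC 0)) as [H0|H0].
  - generalize Hw. apply filter_imp. intros tau [_ H]. rewrite H0.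
    assert (Hr : m21 g <> RtoC 0).
    { intros Hr. apply Hg. rewrite H0, Hr. ring. }
    intros HH. apply (Cmult_neq_0 _ _ Hr H).
    replace (m21 g * w tau) with (- (RtoC 0 - m21 g * w tau)) by ring.
    rewrite HH. ring.
  - apply (filterlim_Cneq _ _ (m11 g + - m21 g * RtoC 0)).
    + replace (m11 g + - m21 g * RtoC 0) with (m11 g) by ring. exact H0.
    + apply (filterlim_ext (fun tau => m11 g + - m21 g * w tau)); [intros; ring|].
      apply filterlim_Cplus; [exact _|apply filterlim_Cconst, _|].
      apply filterlim_Cmult; [exact _|apply filterlim_Cconst, _|exact HL]. }
destruct (filter_and _ _ Hw Hden) as [Y2 HY2].
set (Y := Rmax Y1 Y2).
assert (HYl : forall tau, (Y < Im tau)%R -> (Y1 < Im tau)%R /\ (Y2 < Im tau)%R).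
{ intros tau H. split; (eapply Rle_lt_trans; [|exact H]); [apply Rmax_l|apply Rmax_r]. }
destruct (has_jet_mobius (fun tau => (Y < Im tau)%R) w w1 w2 w3
  (m22 g) (- m12 g) (- m21 g) (m11 g)) as [f1 [f2 [f3 [HJ' HE]]]].
- intros H. apply Hg. rewrite <- H. ring.
- intros tau Htau. apply HJ, HYl, Htau.
- intros tau Htau. destruct (HY2 tau (proj2 (HYl tau Htau))) as [_ H].
  intros H'. apply H. rewrite <- H'. ring.
- exists Y, (fun z => (m22 g * w z + - m12 g) / (- m21 g * w z + m11 g)), f1, f2, f3.
  split; [|split; [exact HJ'|]].
  + intros tau Htau. destruct (HY2 tau (proj2 (HYl tau Htau))) as [[Hf _] H].
    rewrite (mobius_Fin_inv g (f tau) (w tau) Hg Hf H).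
    f_equal. f_equal. ring.
  + apply (filterlim_ext_loc (fun tau => schwarzian_of_jet (w1 tau) (w2 tau) (w3 tau)));
      [|exact HS].
    exists Y. intros tau Htau. symmetry. apply HE, Htau.
Qed.

(** * Theta constants on the imaginary axis *)

Lemma is_Cseries_RtoC (a : nat -> R) (l : R) :
  is_series a l -> is_Cseries (fun n => RtoC (a n)) (RtoC l).
Proof.
intros H.
apply (filterlim_ext (fun n => RtoC (sum_n a n))).
{ intros n. induction n as [|n IH].
  - rewrite !sum_O. reflexivity.
  - rewrite !sum_Sn, <- IH. apply RtoC_plus. }
apply (filterlim_comp _ _ _ (sum_n a) RtoC _ _ _ H).
intros P [eps HP]. exists eps. intros x Hx. apply HP. split; [exact Hx|].
apply ball_center.
Qed.

Lemma Cexp_imaginary_axis (x t : R) :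
  Cexp (RtoC PI * Ci * RtoC x ^ 2 * ((0, t) : C)) = RtoC (exp (- (PI * (x ^ 2 * t)))).
Proof.
replace (RtoC PI * Ci * RtoC x ^ 2 * ((0, t) : C)) with (RtoC (- (PI * (x ^ 2 * t)))).
- unfold Cexp, RtoC; simpl. rewrite cos_0, sin_0. f_equal; ring.
- apply injective_projections; simpl; ring.
Qed.

Lemma CSeries_RtoC (a : nat -> C) (r : nat -> R) (l : R) :
  (forall n, a n = RtoC (r n)) -> is_series r l -> CSeries a = RtoC l.
Proof.
intros Ha Hr. apply CSeries_unique.
apply (is_series_ext (V := C_NormedModule) (fun n => RtoC (r n))).
- intros n. symmetry. apply Ha.
- apply is_Cseries_RtoC, Hr.
Qed.

Lemma gauss_term_S (t : R) (n : nat) : gauss_term 0 t (S n) = gauss_term 1 t n.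
Proof. unfold gauss_term. rewrite S_INR, Rplus_0_r. reflexivity. Qed.

Lemma gauss_term_0_0 (t : R) : gauss_term 0 t 0 = 1%R.
Proof.
unfold gauss_term. simpl INR.
replace (- (PI * ((0 + 0) ^ 2 * t)))%R with 0%R by ring. apply exp_0.
Qed.

(** The index [-n - 1] of the second half has [(-n - 1 + 1/2)^2 = (n + 1/2)^2], so both halves are
    the same sum. *)
Lemma theta2_imaginary_axis (t : R) : (0 < t)%R ->
  theta2 (0, t)%R = RtoC (2 * gauss_sum (/ 2) t).
Proof.
intros Ht. unfold theta2, ZSeries.
assert (Hs : is_series (gauss_term (/ 2) t) (gauss_sum (/ 2) t))
  by (apply Series_correct, ex_series_gauss_term; lra).
rewrite (fun a Ha => CSeries_RtoC a _ _ Ha Hs), (fun a Ha => CSeries_RtoC a _ _ Ha Hs).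
- rewrite <- RtoC_plus. f_equal. ring.
- intros n. rewrite Cexp_imaginary_axis. unfold gauss_term.
  rewrite minus_IZR, opp_IZR, <- INR_IZR_INZ. do 3 f_equal. field.
- intros n. rewrite Cexp_imaginary_axis. unfold gauss_term.
  rewrite <- INR_IZR_INZ. reflexivity.
Qed.

Lemma theta3_imaginary_axis (t : R) : (0 < t)%R ->
  theta3 (0, t)%R = RtoC (1 + 2 * gauss_sum 1 t).
Proof.
intros Ht. unfold theta3, ZSeries.
assert (Hs : is_series (gauss_term 1 t) (gauss_sum 1 t))
  by (apply Series_correct, ex_series_gauss_term; lra).
assert (Hs0 : is_series (gauss_term 0 t) (1 + gauss_sum 1 t)%R).
{ apply is_series_decr_1. apply (is_series_ext (gauss_term 1 t)).
  - intros n. symmetry. apply gauss_term_S.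
  - rewrite gauss_term_0_0. unfold plus, opp; simpl.
    replace (1 + gauss_sum 1 t + - (1))%R with (gauss_sum 1 t) by ring. exact Hs. }
rewrite (fun a Ha => CSeries_RtoC a _ _ Ha Hs0), (fun a Ha => CSeries_RtoC a _ _ Ha Hs).
- rewrite <- RtoC_plus. f_equal. ring.
- intros n. rewrite Cexp_imaginary_axis. unfold gauss_term.
  rewrite minus_IZR, opp_IZR, <- INR_IZR_INZ. do 3 f_equal. ring.
- intros n. rewrite Cexp_imaginary_axis. unfold gauss_term.
  rewrite <- INR_IZR_INZ, Rplus_0_r. reflexivity.
Qed.

Lemma Zeven_sign (n : nat) :
  (if Z.even (Z.of_nat n) then RtoC 1 else RtoC (-1)) = RtoC ((-1) ^ n).
Proof.
induction n as [|n IH]; [reflexivity|].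
rewrite Nat2Z.inj_succ, Z.even_succ, <- Z.negb_even.
simpl pow. rewrite RtoC_mult, <- IH.
destruct (Z.even (Z.of_nat n)); simpl negb; cbv iota;
  rewrite <- RtoC_mult; f_equal; ring.
Qed.

Lemma theta4_imaginary_axis (t : R) : (0 < t)%R ->
  theta4 (0, t)%R = RtoC (1 - 2 * gauss_alt_sum 1 t).
Proof.
intros Ht. unfold theta4, ZSeries.
assert (Hs : is_series (fun n => (-1) ^ n * gauss_term 1 t n)%R (gauss_alt_sum 1 t))
  by (apply Series_correct, ex_series_gauss_alt; lra).
(* Starting at index 1 instead of 0 flips the sign of the alternating factor, on the negative half
   as well as on the positive one. *)
assert (Hs1 : is_series (fun n => (-1) ^ S n * gauss_term 1 t n)%R (- gauss_alt_sum 1 t)%R).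
{ apply (is_series_ext (fun n => opp ((-1) ^ n * gauss_term 1 t n)%R)).
  - intros n. change (- ((-1) ^ n * gauss_term 1 t n) = (-1) ^ S n * gauss_term 1 t n)%R.
    simpl pow. ring.
  - apply (is_series_opp (V := R_NormedModule)), Hs. }
assert (Hs0 : is_series (fun n => (-1) ^ n * gauss_term 0 t n)%R (1 - gauss_alt_sum 1 t)%R).
{ apply is_series_decr_1.
  apply (is_series_ext (fun n => (-1) ^ S n * gauss_term 1 t n)%R).
  - intros n. rewrite gauss_term_S. reflexivity.
  - rewrite gauss_term_0_0. unfold plus, opp; simpl.
    replace (1 - gauss_alt_sum 1 t + - (1 * 1))%R with (- gauss_alt_sum 1 t)%R by ring.
    exact Hs1. }
rewrite (fun a Ha => CSeries_RtoC a _ _ Ha Hs0), (fun a Ha => CSeries_RtoC a _ _ Ha Hs1).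
- rewrite <- RtoC_plus. f_equal. ring.
- intros n. rewrite Cexp_imaginary_axis.
  replace (- Z.of_nat n - 1)%Z with (- Z.of_nat (S n))%Z by lia.
  rewrite Z.even_opp, Zeven_sign, <- RtoC_mult, opp_IZR, <- INR_IZR_INZ, S_INR.
  unfold gauss_term. do 2 f_equal. do 2 f_equal. ring.
- intros n. rewrite Cexp_imaginary_axis, Zeven_sign, <- RtoC_mult, <- INR_IZR_INZ.
  unfold gauss_term. rewrite Rplus_0_r. reflexivity.
Qed.

(** * Limits of the theta constants along [tau = i x^2] *)

Lemma filterlim_RtoC_of_bound (r : R -> R) (l K : R) :
  (forall x, 1 <= x -> Rabs (r x - l) <= K / x)%R ->
  filterlim (fun x => RtoC (r x)) (Rbar_locally p_infty) (Clocally (RtoC l)).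
Proof.
intros H P [eps HP]. exists (Rmax 1 (K / eps)). intros x Hx. apply HP.
change (Cmod (RtoC (r x) - RtoC l) < eps)%R.
assert (Hx1 : (1 < x)%R) by (eapply Rle_lt_trans; [apply Rmax_l|exact Hx]).
assert (Hx2 : (K / eps < x)%R) by (eapply Rle_lt_trans; [apply Rmax_r|exact Hx]).
rewrite <- RtoC_minus, Cmod_R.
eapply Rle_lt_trans; [apply H; lra|].
apply Rlt_div_l; [lra|]. rewrite Rmult_comm.
apply Rlt_div_l in Hx2; [exact Hx2|apply cond_pos].
Qed.

Lemma filterlim_Cpow {T} (F : (T -> Prop) -> Prop) {FF : Filter F} (f : T -> C) (x : C) (n : nat) :
  filterlim f F (Clocally x) -> filterlim (fun t => f t ^ n) F (Clocally (x ^ n)).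
Proof.
intros Hf. induction n as [|n IH]; simpl Cpow.
- apply filterlim_Cconst, FF.
- apply filterlim_Cmult; assumption.
Qed.

Lemma filterlim_C_unique {T} (F : (T -> Prop) -> Prop) {FF : ProperFilter F}
  (f : T -> C) (x y : C) :
  filterlim f F (Clocally x) -> filterlim f F (Clocally y) -> x = y.
Proof.
exact (filterlim_locally_unique (V := AbsRing_NormedModule C_AbsRing) f x y).
Qed.

(** Squaring the parameter makes [sqrt(tau / i) = x] rational in x, and [tau -> -1/tau] becomes
    [x -> 1/x] on this path. *)
Definition i_sqr (x : R) : C := (0%R, (x ^ 2)%R).

Lemma filterlim_i_sqr : filterlim i_sqr (Rbar_locally p_infty) at_i_infty.
Proof.
intros P [Y HP]. exists (Rmax 1 Y). intros x Hx. apply HP. simpl.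
assert (Hx1 : (1 < x)%R) by (eapply Rle_lt_trans; [apply Rmax_l|exact Hx]).
assert (Hx2 : (Y < x)%R) by (eapply Rle_lt_trans; [apply Rmax_r|exact Hx]).
nra.
Qed.

Lemma div_sqr_le (K x : R) : (0 <= K)%R -> (1 <= x)%R -> (K / x ^ 2 <= K / x)%R.
Proof.
intros HK Hx. apply Rmult_le_compat_l; [exact HK|].
apply Rinv_le_contravar; nra.
Qed.

Lemma gauss_alt_sum_le (t : R) : (1 <= t)%R -> (0 <= gauss_alt_sum 1 t <= 2 / t)%R.
Proof.
intros Ht. destruct (gauss_alt_sum_bounds 1 t) as [H1 H2]; try lra.
split; [exact H1|]. eapply Rle_trans; [exact H2|]. apply gauss_term_0_le; lra.
Qed.

Lemma theta_limits_at_i_infty :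
  filterlim (fun x => theta2 (i_sqr x)) (Rbar_locally p_infty) (Clocally (RtoC 0)) /\
  filterlim (fun x => theta3 (i_sqr x)) (Rbar_locally p_infty) (Clocally (RtoC 1)) /\
  filterlim (fun x => theta4 (i_sqr x)) (Rbar_locally p_infty) (Clocally (RtoC 1)).
Proof.
assert (Hloc : Rbar_locally p_infty (fun x => 0 < x ^ 2)%R).
{ exists 1%R. intros x Hx. nra. }
assert (Hsq : forall x, (1 <= x -> 1 <= x ^ 2)%R) by (intros; nra).
split; [|split].
- apply (filterlim_ext_loc (fun x => RtoC (2 * gauss_sum (/ 2) (x ^ 2)))).
  { revert Hloc. apply filter_imp. intros x Hx. symmetry. apply theta2_imaginary_axis, Hx. }
  apply (filterlim_RtoC_of_bound _ 0 8). intros x Hx.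
  assert (B := gauss_sum_bounds (/ 2) (x ^ 2) ltac:(lra) (Hsq x Hx)).
  assert (D := div_sqr_le 4 x ltac:(lra) Hx).
  rewrite Rabs_pos_eq by lra. replace (8 / x)%R with (2 * (4 / x))%R by (field; lra). lra.
- apply (filterlim_ext_loc (fun x => RtoC (1 + 2 * gauss_sum 1 (x ^ 2)))).
  { revert Hloc. apply filter_imp. intros x Hx. symmetry. apply theta3_imaginary_axis, Hx. }
  apply (filterlim_RtoC_of_bound _ 1 8). intros x Hx.
  assert (B := gauss_sum_bounds 1 (x ^ 2) ltac:(lra) (Hsq x Hx)).
  assert (D := div_sqr_le 4 x ltac:(lra) Hx).
  rewrite Rabs_pos_eq by lra. replace (8 / x)%R with (2 * (4 / x))%R by (field; lra). lra.
- apply (filterlim_ext_loc (fun x => RtoC (1 - 2 * gauss_alt_sum 1 (x ^ 2)))).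
  { revert Hloc. apply filter_imp. intros x Hx. symmetry. apply theta4_imaginary_axis, Hx. }
  apply (filterlim_RtoC_of_bound _ 1 4). intros x Hx.
  assert (B := gauss_alt_sum_le (x ^ 2) (Hsq x Hx)).
  assert (D := div_sqr_le 2 x ltac:(lra) Hx).
  rewrite Rabs_left1 by lra. replace (4 / x)%R with (2 * (2 / x))%R by (field; lra). lra.
Qed.

(* A weak form of the inversion formulas: [theta2 (-1/tau) = sqrt(tau/i) theta4 tau]
   and so on, in the limit [tau = i x^2] with [x] tending to infinity. *)
Lemma theta_limits_at_0 :
  filterlim (fun x => RtoC (/ x) * theta2 (i_sqr (/ x))) (Rbar_locally p_infty)
    (Clocally (RtoC 1)) /\
  filterlim (fun x => RtoC (/ x) * theta3 (i_sqr (/ x))) (Rbar_locally p_infty)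
    (Clocally (RtoC 1)) /\
  filterlim (fun x => RtoC (/ x) * theta4 (i_sqr (/ x))) (Rbar_locally p_infty)
    (Clocally (RtoC 0)).
Proof.
assert (Hloc : Rbar_locally p_infty (fun x => 0 < (/ x) ^ 2)%R).
{ exists 1%R. intros x Hx. apply pow_lt, Rinv_0_lt_compat. lra. }
split; [|split].
- apply (filterlim_ext_loc (fun x => RtoC (/ x * (2 * gauss_sum (/ 2) ((/ x) ^ 2))))).
  { revert Hloc. apply filter_imp. intros x Hx. rewrite RtoC_mult. unfold i_sqr.
    rewrite theta2_imaginary_axis by exact Hx. reflexivity. }
  apply (filterlim_RtoC_of_bound _ 1 2). intros x Hx.
  assert (Hd : (0 < / x)%R) by (apply Rinv_0_lt_compat; lra).
  assert (B := gauss_sum_near_0 (/ 2) (/ x) ltac:(lra) Hd).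
  apply Rabs_le_between in B. unfold Rdiv. apply Rabs_le. lra.
- apply (filterlim_ext_loc (fun x => RtoC (/ x * (1 + 2 * gauss_sum 1 ((/ x) ^ 2))))).
  { revert Hloc. apply filter_imp. intros x Hx. rewrite RtoC_mult. unfold i_sqr.
    rewrite theta3_imaginary_axis by exact Hx. reflexivity. }
  (* Of the constant 3, one unit comes from the term of index 0 and two from twice the error in
     [gauss_sum_near_0]. *)
  apply (filterlim_RtoC_of_bound _ 1 3). intros x Hx.
  assert (Hd : (0 < / x)%R) by (apply Rinv_0_lt_compat; lra).
  assert (B := gauss_sum_near_0 1 (/ x) ltac:(lra) Hd).
  apply Rabs_le_between in B. unfold Rdiv. apply Rabs_le. lra.
- apply (filterlim_ext_loc (fun x => RtoC (/ x * (1 - 2 * gauss_alt_sum 1 ((/ x) ^ 2))))).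
  { revert Hloc. apply filter_imp. intros x Hx. rewrite RtoC_mult. unfold i_sqr.
    rewrite theta4_imaginary_axis by exact Hx. reflexivity. }
  apply (filterlim_RtoC_of_bound _ 0 1). intros x Hx.
  assert (Hd : (0 < / x)%R) by (apply Rinv_0_lt_compat; lra).
  assert (Ht : (0 < (/ x) ^ 2)%R) by (apply pow_lt, Hd).
  destruct (gauss_alt_sum_bounds 1 ((/ x) ^ 2) ltac:(lra) Ht) as [B1 B2].
  assert (B3 : (gauss_term 1 ((/ x) ^ 2) 0 <= 1)%R).
  { eapply Rle_trans; [|apply Req_le, (gauss_term_0_0 ((/ x) ^ 2))].
    apply exp_le_compat, Ropp_le_contravar, Rmult_le_compat_l; [apply Rlt_le, PI_RGT_0|].
    apply Rmult_le_compat_r; [lra|]. simpl. lra. }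
  (* The alternating sum lies between 0 and 1, so one minus twice it has modulus at most 1. *)
  unfold Rdiv. apply Rabs_le. nra.
Qed.

(** * Comparison of the limits at the two cusps *)

Lemma Copen_Im_gt (Y : R) : Copen (fun z => (Y < Im z)%R).
Proof.
intros z Hz. assert (H : (0 < Im z - Y)%R) by lra.
exists (mkposreal _ H). intros w Hw.
change (Cmod (w - z) < Im z - Y)%R in Hw.
assert (Hi : (Rabs (Im w - Im z) <= Cmod (w - z))%R).
{ apply Rle_trans with (2 := Rmax_Cmod (w - z)), Rmax_r. }
apply Rabs_le_between in Hi. lra.
Qed.

Lemma Copen_inversion (D : C -> Prop) : Copen D ->
  Copen (fun z => z <> RtoC 0 /\ D (RtoC (-1) / z)).
Proof.
intros HD z [Hz HDz]. apply filter_and.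
- apply (filterlim_Cneq (Clocally z) (fun w => w) z (RtoC 0) Hz). apply filterlim_id.
- assert (H := is_holo_derive_div (fun _ => RtoC (-1)) (fun w => w) z _ _ Hz
    (is_holo_derive_const _ z) (is_holo_derive_id z)).
  apply (is_holo_derive_continuous _ _ _ H). apply HD, HDz.
Qed.

Theorem theorem4p5 (a b : C) (h : C -> P1) (m1 m2 n1 n2 : nat)
  (h_mero : meromorphic_on_H h)
  (h_nonconst : nonconstant_on_H h)
  (h_schwarz : schwarzian_eq_on_H h
     (fun tau => a * (theta3 tau * theta4 tau) ^ 4 + b * theta2 tau ^ 8))
  (h_modular : exists G : mat2 Z -> Prop,
     finite_index_subgroup G /\ modular_function h G)
  (h_m1 : least_positive (fun m => forall tau : C, upper_half_plane tau ->
     h (tau + RtoC (INR m)) = h tau) m1)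
  (h_m2 : least_positive (fun m => forall tau : C, upper_half_plane tau ->
     h (tau / (RtoC 1 - RtoC (INR m) * tau)) = h tau) m2)
  (h_n1 : ramification_at_i_infty h m1 n1)
  (h_n2 : ramification_at_i_infty (fun tau => h (RtoC (-1) / tau)) m2 n2) :
  a = RtoC 2 * RtoC PI ^ 2 * (RtoC (INR n1) / RtoC (INR m1)) ^ 2 /\
  b = RtoC 2 * RtoC PI ^ 2 * (RtoC (INR n2) / RtoC (INR m2)) ^ 2.
Proof.
split.
- destruct (ramification_jet h m1 n1 (proj1 h_m1) h_n1)
    as [Y [f [f1 [f2 [f3 [Hf [HJ HS]]]]]]].
  assert (HS' := filterlim_comp _ _ _ _ _ _ _ _ filterlim_i_sqr HS).
  (* The same Schwarzian along [i x^2] has one limit from the ramification and one from the theta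
     constants; the latter is a. *)
  refine (filterlim_C_unique (Rbar_locally p_infty) _ _ _ _ HS').
  destruct theta_limits_at_i_infty as [L2 [L3 L4]].
  replace a with (a * (RtoC 1 * RtoC 1) ^ 4 + b * RtoC 0 ^ 8) at 1 by ring.
  apply (filterlim_ext_loc (fun x => a * (theta3 (i_sqr x) * theta4 (i_sqr x)) ^ 4 +
    b * theta2 (i_sqr x) ^ 8)).
  + apply (filterlim_i_sqr (fun tau =>
      a * (theta3 tau * theta4 tau) ^ 4 + b * theta2 tau ^ 8 =
      schwarzian_of_jet (f1 tau) (f2 tau) (f3 tau))).
    exists (Rmax 0 Y). intros tau Htau.
    assert (H0 : (0 < Im tau)%R) by (eapply Rle_lt_trans; [apply Rmax_l|exact Htau]).
    assert (HY : (Y < Im tau)%R) by (eapply Rle_lt_trans; [apply Rmax_r|exact Htau]).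
    destruct (schwarzian_has_jet _ f f1 f2 f3 (fun w => chart0 (h w)) tau
      (Copen_Im_gt Y) HJ) as [HN HE].
    * intros w Hw. rewrite (Hf w Hw). reflexivity.
    * exact HY.
    * rewrite <- HE. symmetry. apply h_schwarz; [exact H0| |exact HN].
      rewrite (Hf tau HY). discriminate.
  + apply filterlim_Cplus; [exact _| |];
      (apply filterlim_Cmult; [exact _|apply filterlim_Cconst; exact _|]);
      (apply filterlim_Cpow; [exact _|]); [|exact L2].
    apply filterlim_Cmult; [exact _|exact L3|exact L4].
- destruct (ramification_jet _ m2 n2 (proj1 h_m2) h_n2)
    as [Y [f [f1 [f2 [f3 [Hf [HJ HS]]]]]]].
  assert (HS' := filterlim_comp _ _ _ _ _ _ _ _ filterlim_i_sqr HS).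
  refine (filterlim_C_unique (Rbar_locally p_infty) _ _ _ _ HS').
  destruct theta_limits_at_0 as [L2 [L3 L4]].
  (* Eight factors [1/x] are spread over the thetas; the a-term then contains the fourth power of
     the scaled [theta4], whose limit is 0. *)
  replace b with (a * (RtoC 1 ^ 4 * RtoC 0 ^ 4) + b * RtoC 1 ^ 8) at 1 by ring.
  destruct (has_jet_inversion _ f f1 f2 f3 HJ) as [g1 [g2 [g3 [HJ' HE']]]].
  apply (filterlim_ext_loc (fun x =>
    a * ((RtoC (/ x) * theta3 (i_sqr (/ x))) ^ 4 * (RtoC (/ x) * theta4 (i_sqr (/ x))) ^ 4) +
    b * (RtoC (/ x) * theta2 (i_sqr (/ x))) ^ 8)).
  + assert (HY : Rbar_locally p_infty (fun x => Y < Im (i_sqr x))%R)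
      by (apply (filterlim_i_sqr (fun z => Y < Im z)%R); exists Y; auto).
    assert (Hx : Rbar_locally p_infty (fun x => 0 < x)%R) by (exists 0%R; auto).
    generalize (filter_and _ _ HY Hx). apply filter_imp. clear HY Hx.
    intros x [HY Hx].
    set (s := i_sqr (/ x)).
    assert (Hd : (0 < / x)%R) by (apply Rinv_0_lt_compat, Hx).
    assert (Hs : (0 < Im s)%R) by (apply (pow_lt _ 2), Hd).
    assert (Hs0 : forall w, (0 < Im w)%R -> w <> RtoC 0)
      by (intros w Hw ->; simpl in Hw; lra).
    assert (Es : RtoC (-1) / s = i_sqr x).
    { replace (RtoC (-1)) with (s * i_sqr x).
      - field. apply Hs0, Hs.
      - apply injective_projections; simpl; field; lra. }
    destruct (schwarzian_has_jet _ _ g1 g2 g3 (fun w => chart0 (h w)) s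
      (Copen_inversion _ (Copen_Im_gt Y)) HJ') as [HN HE].
    * intros w [Hw HYw]. specialize (Hf _ HYw). cbv beta in Hf.
      (* Here f represents [h(-1/tau)], so h itself is f composed with the inversion, an
         involution. *)
      replace (RtoC (-1) / (RtoC (-1) / w)) with w in Hf.
      -- rewrite Hf. reflexivity.
      -- field. exact Hw.
    * split; [apply Hs0, Hs|rewrite Es; exact HY].
    * assert (HF : h s = Fin (f (i_sqr x))).
      { rewrite <- (Hf _ HY). f_equal. rewrite <- Es.
        field. apply Hs0, Hs. }
      rewrite HE' in HE by (try rewrite Es; auto).
      rewrite h_schwarz, Es in HE; [|exact Hs|rewrite HF; discriminate|exact HN].
      (* As [i^4 = 1], the weight factor is real and equals [x^-8]: exactly the scaling of eight
         theta factors. *)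
      assert (Es4 : s ^ 4 = RtoC (/ x) ^ 8).
      { apply injective_projections; simpl; ring. }
      rewrite Es4 in HE.
      assert (Hd8 : RtoC (/ x) <> RtoC 0) by (intros H; apply RtoC_inj in H; lra).
      transitivity ((a * (theta3 s * theta4 s) ^ 4 + b * theta2 s ^ 8) * RtoC (/ x) ^ 8);
        [ring|].
      rewrite HE. unfold i_sqr. field. exact Hd8.
  + apply filterlim_Cplus; [exact _| |];
      (apply filterlim_Cmult; [exact _|apply filterlim_Cconst; exact _|]).
    * apply filterlim_Cmult; [exact _| |]; apply filterlim_Cpow; auto with typeclass_instances.
    * apply filterlim_Cpow; auto with typeclass_instances.
Qed.
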